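(* The number of irreducible constituents of the $U$-module $Top$ is: $\bullet$ $q^\ell-q^{\ell-1}$ if $m=1$; $\bullet$ $2(q^\ell-q^{\ell-1})$ if $m=2$ and $h$ is of type $\{1,-\epsilon\}$; $\bullet$ $2q^\ell$ if $m>2$, or $m=2$ and $h$ is of type $\{1,-1\}$.
   Context: Setting. $R$ is a finite commutative local principal ring of odd prime characteristic $p$, with maximal ideal $\mathfrak m$ of nilpotency degree $\ell\ge 1$ and residue field $R/\mathfrak m\cong F_q$. Let $x$ be a generator of $\mathfrak m$ and $A=R[t]/(t^2-x)=R\oplus Ry$, $y^2=x$ (ramified quadratic extension of $R$), with involution $(r+sy)^*=r-sy$ ($r,s\in R$). $A$ is a finite local principal ring with maximal ideal $\mathfrak r=Ay$ of nilpotency degree $2\ell$ and residue field $F_q$. Put $\mathfrak i=\mathfrak r^\ell=Ay^\ell$. $V$ is a free $A$-module of finite rank $m\ge 1$ and $h:V\times V\to A$ is a non-degenerate hermitian form: $h$ is bi-additive, $A$-linear in the second variable, $h(v,u)=h(u,v)^*$, and $v\mapsto h(v,-)$ is a bijection $V\to \mathrm{Hom}_A(V,A)$. $U=\{g\in \mathrm{GL}_A(V): h(gu,gv)=h(u,v)\ \forall u,v\in V\}$. Let $d:A\to R$, $d(r+sy)=2s$. Fix a primitive linear character $\lambda:R^+\to\mathbf C^\times$ (its kernel contains no non-zero ideal of $R$) and put $\mu=\lambda\circ d:A^+\to\mathbf C^\times$. Weil module. Let $T$ be a transversal for $\mathfrak iV$ in $V$. The Weil module $X$ (of type $\mu$)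 is the complex $U$-module with basis $\{e_v: v\in T\}$ and action $ge_v=\mu(h(gv,v'))e_{v'}$ for $g\in U$, $v,v'\in T$, $gv\equiv v' \bmod \mathfrak iV$. A vector $v\in V$ is primitive if $v\notin yV$. $Top$ is the $U$-submodule of $X$ spanned by the $e_v$ with $v\in T$ primitive. ($Top$ is multiplicity free.) Types. $\epsilon$ is a fixed element of $R^\times$ that is not a square in $R^\times$. For $r_1,\dots,r_m\in R^\times$, $h$ is of type $\{r_1,\dots,r_m\}$ if $V$ has a basis relative to which $h$ has matrix $\mathrm{diag}(r_1,\dots,r_m)$. (For $m=2$, $h$ is of exactly one of the types $\{1,-1\}$, $\{1,-\epsilon\}$.) *)

(* Defs.v *)
From HB Require Import structures.
From mathcomp Require Import all_boot all_order all_algebra all_fingroup.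
From mathcomp Require Import all_field all_character.
From mathcomp Require Import ring.

Set Implicit Arguments.
Unset Strict Implicit.
Unset Printing Implicit Defensive.

Import GroupScope Order.TTheory GRing.Theory Num.Theory.
Local Open Scope ring_scope.

Section FiniteRings.
Variable R : finComUnitRingType.
Implicit Types (I J M : {set R}) (a x : R).

Definition is_ideal I : bool :=
  [&& 0 \in I,
      [forall a in I, forall b in I, a + b \in I] &
      [forall a, forall b in I, a * b \in I]].

Definition maximal_ideal I : Prop :=
  [/\ is_ideal I, I != setT &
      forall J, is_ideal J -> I \subset J -> J = I \/ J = setT].

Definition local_ring M : Prop := forall I, maximal_ideal I <-> I = M.

Definition principal_ideal a : {set R} := [set a * b | b : R].

Definition principal_ring : Prop :=
  forall I, is_ideal I -> exists a, I = principal_ideal a.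

Definition ideal_gen (S : {set R}) : {set R} :=
  \bigcap_(I : {set R} | is_ideal I && (S \subset I)) I.

Definition ideal_mul I J : {set R} := ideal_gen [set a * b | a in I, b in J].

Definition ideal_exp I (n : nat) : {set R} := iter n (ideal_mul I) setT.

Definition nilpotency_degree I (n : nat) : Prop :=
  ideal_exp I n = [set 0] /\
  (forall k, ideal_exp I k = [set 0] -> (n <= k)%N).

(* R / M is isomorphic to F *)
Definition residue_field M (F : finFieldType) : Prop :=
  exists pi : {rmorphism R -> F},
    (forall c, exists a, pi a = c) /\ (forall a, (pi a == 0) = (a \in M)).

(* R is finite, so the values of lam are roots of unity and complex
   representations may be taken over the algebraic complex numbers algC. *)
Definition additive_character (lam : R -> algC) : Prop :=
  lam 0 = 1 /\ {morph lam : a b / a + b >-> a * b}.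

Definition primitive_character (lam : R -> algC) : Prop :=
  forall I, is_ideal I -> (forall a, a \in I -> lam a = 1) -> I = [set 0].

Definition nonsquare_unit a : Prop :=
  a \is a GRing.unit /\ (forall b, b \is a GRing.unit -> b ^+ 2 <> a).

End FiniteRings.

Definition ram_poly (R : finComUnitRingType) (x : R) : {poly R} := 'X^2 - x%:P.

(* A = R[t] / (t^2 - x); since t^2 - x is monic of degree 2, [mk_monic] leaves
   it unchanged, and the coefficients of r + s y are r and s. *)
Notation ramext x := {poly %/ ram_poly x}.

Section RamifiedExtension.
Variables (R : finComUnitRingType) (x : R).
Implicit Type a : ramext x.

Definition ram_y : ramext x := 'qX.

Definition ram_conj a : ramext x :=
  qpolyC _ (a : {poly R})`_0 - (a : {poly R})`_1 *: ram_y.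

Definition ram_d a : R := (a : {poly R})`_1 *+ 2.

End RamifiedExtension.

Section Hermitian.
Variables (R : finComUnitRingType) (x : R) (V : finLmodType (ramext x)).
Implicit Types (u v w : V) (h : V -> V -> ramext x).

Definition is_basis n (b : 'I_n -> V) : Prop :=
  forall v, exists! c : {ffun 'I_n -> ramext x}, v = \sum_i c i *: b i.

Definition free_of_rank n : Prop := exists b : 'I_n -> V, is_basis b.

Definition hermitian_form h : Prop :=
  [/\ forall u v w, h (u + v) w = h u w + h v w,
      forall u v w, h u (v + w) = h u v + h u w,
      forall a u v, h u (a *: v) = a * h u v &
      forall u v, h v u = ram_conj (h u v)].

Definition nondegenerate_form h : Prop :=
  forall f : {linear V -> (ramext x)^o}, exists! v, forall w, h v w = f w.

(* the length of rs is the rank of V *)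
Definition of_type h (rs : seq R) : Prop :=
  all (fun r => r \is a GRing.unit) rs /\
  exists b : 'I_(size rs) -> V, is_basis b /\
    forall i j, h (b i) (b j) = if i == j then qpolyC _ rs`_i else 0.

(* In {perm V} the product g * k is g followed by k; correspondingly, the
   representations below act on row vectors on the right. *)
Definition unitary h : {set {perm V}} :=
  [set g : {perm V} |
    [forall a : ramext x, forall u, forall v,
       g (a *: u + v) == a *: g u + g v] &&
    [forall u, forall v, h (g u) (g v) == h u v]].

Lemma unitaryP h (g : {perm V}) :
  reflect ((forall a u v, g (a *: u + v) = a *: g u + g v) /\
           (forall u v, h (g u) (g v) = h u v)) (g \in unitary h).
Proof.
rewrite inE; apply: (iffP andP) => -[Hl Hh]; split.
- by move=> a u v; move/forallP/(_ a)/forallP/(_ u)/forallP/(_ v)/eqP: Hl.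
- by move=> u v; move/forallP/(_ u)/forallP/(_ v)/eqP: Hh.
- by apply/forallP=> a; apply/forallP=> u; apply/forallP=> v; apply/eqP.
- by apply/forallP=> u; apply/forallP=> v; apply/eqP.
Qed.

Lemma unitary_group_set h : group_set (unitary h).
Proof.
apply/group_setP; split=> [|g k /unitaryP[gl gh] /unitaryP[kl kh]].
  by apply/unitaryP; split=> *; rewrite !perm1.
by apply/unitaryP; split=> *; rewrite !permM ?gl ?kl // kh gh.
Qed.

Canonical unitary_group h := Group (unitary_group_set h).

(* y^k V; for k = l this is iV, because i = A y^l *)
Definition yV (k : nat) : {set V} := [set ram_y x ^+ k *: w | w : V].

Definition primitive_vector v : bool := v \notin yV 1.

Definition transversal_mod (S T : {set V}) : Prop :=
  forall v, exists! t, t \in T /\ v - t \in S.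

End Hermitian.

Section RamTheory.
Variables (R : finComUnitRingType) (x : R).
Implicit Type a b : ramext x.

Lemma size_rampoly : size (ram_poly x) = 3.
Proof. by rewrite /ram_poly size_polyDl ?size_polyXn // size_polyN size_polyC;
   case: eqP. Qed.

Lemma monic_rampoly : ram_poly x \is monic.
Proof.
rewrite /ram_poly monicE lead_coefDl ?lead_coefXn // size_polyXn size_polyN size_polyC.
by case: eqP.
Qed.

Lemma mk_monic_ram : mk_monic (ram_poly x) = ram_poly x.
Proof. by rewrite /mk_monic size_rampoly monic_rampoly. Qed.

Lemma ram_coef_ge2 a i : (1 < i)%N -> (a : {poly R})`_i = 0.
Proof.
by move=> i1; rewrite big_coef_npoly // mk_monic_ram size_rampoly.
Qed.

Lemma ram_ext a b : (a : {poly R})`_0 = (b : {poly R})`_0 ->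
  (a : {poly R})`_1 = (b : {poly R})`_1 -> a = b.
Proof.
move=> e0 e1; apply/npolyP=> -[|[|i]] //; by rewrite !ram_coef_ge2.
Qed.

Lemma ram_yE : (ram_y x : {poly R}) = 'X.
Proof. by rewrite qpolyXE ?size_rampoly // monic_rampoly. Qed.

Lemma ram_yM a : ram_y x * a =
  in_qpoly _ (((a : {poly R})`_1 * x)%:P + (a : {poly R})`_0 *: 'X).
Proof.
have Ea : (a : {poly R}) = ((a : {poly R})`_0)%:P + (a : {poly R})`_1 *: 'X.
  apply/polyP=> -[|[|i]]; rewrite coefD coefZ coefX coefC /= ?(mulr0,mulr1,addr0,add0r) //.
  by rewrite ram_coef_ge2.
apply: val_inj; rewrite /= [Pdiv.CommonRing.rmodp 'X _]ram_yE {1}Ea.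
move: (polyn a)`_0 (polyn a)`_1 => c d; rewrite mk_monic_ram.
have -> : 'X * (c%:P + d *: 'X) =
    (d * x)%:P + c *: 'X + d%:P * ram_poly x.
  rewrite /ram_poly polyCM -!mul_polyC; ring.
rewrite Pdiv.RingMonic.rmodpD ?monic_rampoly //.
by rewrite Pdiv.RingMonic.rmodp_mull ?monic_rampoly // addr0.
Qed.

Lemma size_lin (c d : R) : (size (c%:P + d *: 'X)%R < 3)%N.
Proof.
rewrite ltnS (leq_trans (size_polyD _ _)) // geq_max.
rewrite (leq_trans (size_polyC_leq1 _)) //=.
by rewrite (leq_trans (size_scale_leq _ _)) // size_polyX.
Qed.

Lemma ram_yM_coef a :
  ((ram_y x * a : ramext x) : {poly R})`_0 = (a : {poly R})`_1 * x /\
  ((ram_y x * a : ramext x) : {poly R})`_1 = (a : {poly R})`_0.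
Proof.
rewrite ram_yM in_qpoly_small; last first.
  move: (polyn a)`_0 (polyn a)`_1 => c d.
  by rewrite mk_monic_ram size_rampoly size_lin.
by rewrite !coefD !coefZ !coefX !coefC /= mulr0 mulr1 addr0 add0r.
Qed.

Lemma ram_conj_coef a :
  ((ram_conj a : ramext x) : {poly R})`_0 = (a : {poly R})`_0 /\
  ((ram_conj a : ramext x) : {poly R})`_1 = - (a : {poly R})`_1.
Proof.
have -> : (ram_conj a : {poly R}) =
  ((a : {poly R})`_0)%:P - (a : {poly R})`_1 *: 'X by rewrite -ram_yE.
rewrite !coefB !coefZ.
by rewrite !coefX !coefC /= mulr0 mulr1 subr0 sub0r.
Qed.

Lemma ram_conj_yM a : ram_conj (ram_y x * a) = - (ram_y x * ram_conj a).
Proof.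
have [p0 p1] := ram_conj_coef (ram_y x * a).
have [q0 q1] := ram_yM_coef a.
have [r0 r1] := ram_conj_coef a.
have [s0 s1] := ram_yM_coef (ram_conj a).
apply: ram_ext; rewrite /= coefN.
  by rewrite p0 q0 s0 r1 mulNr opprK.
by rewrite p1 q1 s1 r0.
Qed.

Lemma ram_conj_yXM k a :
  ram_conj (ram_y x ^+ k * a) = (-1) ^+ k * (ram_y x ^+ k * ram_conj a).
Proof.
elim: k => [|k IH]; first by rewrite !expr0 !mul1r.
by rewrite !exprS -mulrA ram_conj_yM IH; ring.
Qed.

Lemma ram_dD a b : ram_d (a + b) = ram_d a + ram_d b.
Proof. by rewrite /ram_d /= coefD mulrnDl. Qed.

Lemma ram_d0 : ram_d (0 : ramext x) = 0.
Proof. by rewrite /ram_d /= coef0 mul0rn. Qed.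

Lemma ram_d_selfadj a : a = ram_conj a -> ram_d a = 0.
Proof.
move=> e; have [_] := ram_conj_coef a; rewrite -e /ram_d mulr2n => {1}->.
exact: addNr.
Qed.

Lemma ram_y2 : ram_y x ^+ 2 = qpolyC _ x.
Proof.
have [s0 s1] := ram_yM_coef (ram_y x).
rewrite expr2; apply: ram_ext; rewrite ?s0 ?s1 ram_yE !coefX !coefC /= //.
by rewrite mul1r.
Qed.

Lemma genS_ideal (S : {set R}) : S \subset ideal_gen S.
Proof. by apply/bigcapsP=> I /andP[]. Qed.

Lemma ram_y_nil (M : {set R}) l : M = principal_ideal x ->
  nilpotency_degree M l -> ram_y x ^+ l * ram_y x ^+ l = 0.
Proof.
move=> eM [Ml _]; have xM : x \in M.
  by rewrite eM; apply/imsetP; exists 1; rewrite ?mulr1.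
have xl : x ^+ l \in ideal_exp M l.
  rewrite /ideal_exp; elim: (l) => [|k IH]; first by rewrite inE.
  rewrite exprS iterS; apply: (subsetP (genS_ideal _)).
  by apply/imset2P; exists x (x ^+ k).
move: xl; rewrite Ml inE => /eqP xl.
by rewrite -exprMn -expr2 ram_y2 -rmorphXn xl rmorph0.
Qed.

End RamTheory.

Section WeilModule.
Variables (R : finComUnitRingType) (M : {set R}) (x : R) (l : nat).
Variables (V : finLmodType (ramext x)) (h : V -> V -> ramext x).
Variables (lam : R -> algC) (T : {set V}).

Definition weil_mu (a : ramext x) : algC := lam (ram_d a).

(* The i-th row is the image of e_v, where v = enum_val i. *)
Definition weil_mx (g : {perm V}) : 'M[algC]_#|T| :=
  \matrix_(i, j)
    let v := enum_val i in let v' := enum_val j in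
    if g v - v' \in yV V l then weil_mu (h (g v) v') else 0.

Definition top_mx : 'M[algC]_#|T| :=
  (\sum_(i < #|T| | primitive_vector (enum_val i)) <<delta_mx 0 i : 'rV_#|T|>>)%MS.

Hypothesis Mx : M = principal_ideal x.
Hypothesis nilM : nilpotency_degree M l.
Hypothesis herm_h : hermitian_form h.
Hypothesis lamP : additive_character lam.
Hypothesis trT : transversal_mod (yV V l) T.

Lemma weil_muD a b : weil_mu (a + b) = weil_mu a * weil_mu b.
Proof. by case: lamP => _ E; rewrite /weil_mu ram_dD E. Qed.

Lemma weil_mu0 : weil_mu 0 = 1.
Proof. by case: lamP => E _; rewrite /weil_mu ram_d0 E. Qed.

Lemma weil_mu_diag v : weil_mu (h v v) = 1.
Proof.
case: herm_h => _ _ _ hs; case: lamP => E _.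
by rewrite /weil_mu ram_d_selfadj.
Qed.

Lemma yV0 k : 0 \in yV V k.
Proof. by apply/imsetP; exists 0; rewrite ?scaler0. Qed.

Lemma yVD k u v : u \in yV V k -> v \in yV V k -> u + v \in yV V k.
Proof.
case/imsetP=> a _ -> /imsetP[b _ ->].
by apply/imsetP; exists (a + b); rewrite ?scalerDr.
Qed.

Lemma yVN k u : u \in yV V k -> - u \in yV V k.
Proof. by case/imsetP=> a _ ->; apply/imsetP; exists (- a); rewrite ?scalerN. Qed.

Lemma yV_ii u v : u \in yV V l -> v \in yV V l -> h u v = 0.
Proof.
case: herm_h => _ _ hZ hs /imsetP[a _ ->] /imsetP[b _ ->].
rewrite hZ (hs b) hZ ram_conj_yXM mulrCA (mulrA (ram_y x ^+ l)).
by rewrite (ram_y_nil Mx nilM) mul0r mulr0.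
Qed.

Lemma unitary0 g : g \in unitary h -> g 0 = 0.
Proof.
case/unitaryP=> gl _; have := gl (-1) 0 0.
by rewrite scaler0 addr0 scaleN1r addNr.
Qed.

Lemma unitaryD g u v : g \in unitary h -> g (u + v) = g u + g v.
Proof. by case/unitaryP=> gl _; have := gl 1 u v; rewrite !scale1r. Qed.

Lemma unitaryZ g a u : g \in unitary h -> g (a *: u) = a *: g u.
Proof.
by move=> gU; case/unitaryP: (gU) => gl _; have := gl a u 0;
   rewrite unitary0 // !addr0.
Qed.

Lemma unitary_yV g k u : g \in unitary h -> u \in yV V k -> g u \in yV V k.
Proof.
move=> gU /imsetP[a _ ->]; rewrite unitaryZ //.
by apply/imsetP; exists (g a).
Qed.

Lemma hDl u v w : h (u + v) w = h u w + h v w.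
Proof. by case: herm_h. Qed.
Lemma hDr u v w : h u (v + w) = h u v + h u w.
Proof. by case: herm_h. Qed.

Lemma weil_cocycle g k v v' v'' : g \in unitary h -> k \in unitary h ->
  g v - v' \in yV V l -> k v' - v'' \in yV V l ->
  weil_mu (h (g v) v') * weil_mu (h (k v') v'') = weil_mu (h (k (g v)) v'').
Proof.
move=> gU kU; move=> aI bI.
have [a Ea] : {a | a = g v - v'} by exists (g v - v').
have [b Eb] : {b | b = k v' - v''} by exists (k v' - v'').
rewrite -Ea -Eb in aI bI.
have Egv : g v = v' + a by rewrite Ea addrC subrK.
have Ekv : k v' = v'' + b by rewrite Eb addrC subrK.
case/unitaryP: (kU) => _ kh.
rewrite Egv (unitaryD _ _ kU) !hDl !weil_muD weil_mu_diag mul1r mulrC.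
congr (_ * _); rewrite -(kh a v') Ekv hDr (@yV_ii (k a) b) ?addr0 //.
exact: unitary_yV.
Qed.

Lemma weil_rep_exists v : exists2 j : 'I_#|T|, v - enum_val j \in yV V l
  & forall i : 'I_#|T|, v - enum_val i \in yV V l -> i = j.
Proof.
case: (trT v) => t [[tT vt] tu].
exists (enum_rank_in tT t); first by rewrite enum_rankK_in.
move=> i vi; apply: enum_val_inj; rewrite enum_rankK_in //.
by apply/esym/tu; split=> //; apply: enum_valP.
Qed.

Lemma weil_mx_repr : mx_repr (unitary h) weil_mx.
Proof.
split=> [|g k gU kU]; apply/matrixP=> i j; rewrite !mxE /=.
  rewrite perm1; have [j0 j0I j0u] := weil_rep_exists (enum_val i).
  have ei : i = j0 by apply: j0u; rewrite subrr yV0.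
  case: eqP => [<-|ne]; first by rewrite subrr yV0 weil_mu_diag.
  by case: ifP => // /j0u ej; case: ne; rewrite ei ej.
rewrite permM; have [j0 j0I j0u] := weil_rep_exists (g (enum_val i)).
rewrite (bigD1 j0) //= big1 ?addr0 => [|j1 ne]; last first.
  rewrite !mxE /=; case: ifP => [/j0u e|_]; last by rewrite mul0r.
  by rewrite e eqxx in ne.
rewrite !mxE /= j0I.
have kI : k (g (enum_val i)) - k (enum_val j0) \in yV V l.
  suff -> : k (g (enum_val i)) - k (enum_val j0) =
            k (g (enum_val i) - enum_val j0) by apply: unitary_yV.
  by rewrite unitaryD // -[- enum_val j0]scaleN1r unitaryZ // scaleN1r.
case: ifP => I1; case: ifP => I2; rewrite ?mulr0 //.
- by rewrite weil_cocycle.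
- move/negP: I2; case; have := yVD (yVN kI) I1.
  by rewrite opprB addrA subrK.
- move/negP: I1; case; have := yVD kI I2.
  by rewrite addrA subrK.
Qed.

Definition weil_repr : mx_representation algC (unitary_group h) #|T| :=
  MxRepresentation weil_mx_repr.

Hypothesis l_gt0 : (0 < l)%N.

Lemma yV_1 v : v \in yV V l -> v \in yV V 1.
Proof.
case/imsetP=> a _ ->; apply/imsetP; exists (ram_y x ^+ l.-1 *: a) => //.
by rewrite scalerA -exprD add1n prednK.
Qed.

Lemma top_mxmodule : mxmodule weil_repr top_mx.
Proof.
apply/mxmoduleP=> g gU; rewrite /top_mx sumsmxMr.
apply/sumsmx_subP=> i vi.
apply: (@submx_trans _ _ _ _ _ _ (delta_mx 0 i *m weil_mx g)).
  by apply: submxMr; rewrite genmxE.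
rewrite -rowE [X in (X <= _)%MS]row_sum_delta.
apply: summx_sub=> j _; rewrite !mxE /=; case: ifP => [I|_]; last first.
  by rewrite scale0r sub0mx.
apply: scalemx_sub; apply: (sumsmx_sup j); last by rewrite genmxE.
apply: contra vi => vj.
have gv : g (enum_val i) \in yV V 1.
  by have := yVD vj (yV_1 I); rewrite addrC subrK.
have := unitary_yV (groupVr gU) gv; by rewrite permK.
Qed.

Definition top_repr := submod_repr top_mxmodule.

End WeilModule.

(* Distinct constituents are counted; this agrees with the count with
   multiplicity for a multiplicity-free module such as Top. *)
Definition num_irr_constituents (gT : finGroupType) (G : {group gT}) n
  (rG : mx_representation algC G n) : nat := #|irr_constt (cfRepr rG)|.

(* Main.v *)
Require Import Defs.
From HB Require Import structures.
From mathcomp Require Import all_boot all_order all_algebra all_fingroup.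
From mathcomp Require Import all_field all_character.
From mathcomp Require Import ring.

(** Top is multiplicity free, so its constituents are counted by the squared
    norm of its character.  Let i = Ay^l.  The congruence subgroup of U modulo i
    acts diagonally on the e_v, and its character on e_v (v primitive) determines
    v modulo i up to a scalar of norm 1.  These scalars are central in U, so each
    operator commuting with U sends e_v into the span of the e_(av), where it
    agrees with a polynomial in central elements; hence the centralizer is
    commutative.  Summing over pairs (v, w) in the character norm leaves
      (number of norm 1 scalars modulo i) * (number of U-orbits of primitive
      vectors modulo i).
    By Witt's theorem an orbit is determined by h(v, v) modulo i, and the norm map
    on (A/i)^* relates the number of norm 1 scalars to the number of squares in
    the units of the fixed ring modulo i.  Since i is annihilated exactly by i,
    a class modulo i is represented throughout by its multiple by y^l. *)

Set Implicit Arguments.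
Unset Strict Implicit.
Unset Printing Implicit Defensive.

Import GRing.Theory Num.Theory.
Local Open Scope ring_scope.

(** The number N of norm 1 scalars modulo i has a form depending on the parity of l, and it is never
    computed; only products with it are. N times the number of norms of units modulo i is the order
    q^l - q^(l-1) of (A/i)^*. Since A is ramified over R, conjugation is trivial on the residue
    field, so these norms are exactly the squares of fixed units; p being odd, they form half of the
    fixed units modulo i. Hence N times the number of fixed units is 2(q^l - q^(l-1)), and N times
    the number of all fixed elements is 2q^l. The cases of the theorem are the possibilities for the
    set of values h(v, v) modulo i on primitive v: norms times a unit, all fixed units, or all fixed
    elements. Square roots of fixed elements of residue 1 do the work of Hensel's lemma: they lift
    norm 1 scalars, solve a quadratic equation in Witt's theorem, and adjust the length of a
    vector. *)

Section MultiplicityFree.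
Variables (gT : finGroupType) (G : {group gT}) (n : nat).
Variable rG : mx_representation algC G n.

Definition centralizes (B : 'M[algC]_n) : Prop :=
  forall g, g \in G -> rG g *m B = B *m rG g.

(** A constituent of multiplicity at least 2 would split off twice. The two matrix units exchanging
    these copies commute with the group but not with each other. *)
Lemma multiplicity_le1 :
    (forall B C, centralizes B -> centralizes C -> B *m C = C *m B) ->
  forall i, '[cfRepr rG, 'chi_i] <= 1.
Proof.
move=> cBC i; have /natrP[k Dk] := Cnat_cfdot_char_irr i (cfRepr_char rG).
rewrite Dk lern1 leqNgt; apply/negP => k_gt1.
have /constt_charP : i \in irr_constt (cfRepr rG).
  by rewrite irr_consttE Dk pnatr_eq0 -lt0n ltnW.
case/(_ (cfRepr_char rG)) => chi' Cchi' Dchi.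
have /constt_charP : i \in irr_constt chi'.
  rewrite irr_consttE; move: Dk; rewrite Dchi cfdotDl cfnorm_irr => /(canRL (addKr _)) ->.
  by rewrite addrC subr_eq0 pnatr_eq1; case: ltngtP k_gt1.
case/(_ Cchi') => chi'' /char_reprP[rho Drho] Dchi'.
pose rC := Representation 'Chi_i.
have /cfRepr_rsimP[B n_eq Bfree BG] :
    cfRepr rG == cfRepr (dadd_grepr rC (dadd_grepr rC rho)).
  by rewrite !cfRepr_dadd Dchi Dchi' Drho irrRepr.
move: B n_eq Bfree BG => /=.
set d := irr_degree _; set e := rdegree rho => B n_eq Bfree BG.
pose rD : mx_representation algC G (d + (d + e)) := dadd_grepr rC (dadd_grepr rC rho).
have {}BG g : g \in G -> rG g *m B = B *m rD g by apply: BG.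
have rDE g : rD g = block_mx (rC g) 0 0 (block_mx (rC g) 0 0 (rho g)) by [].
have d_gt0 : (0 < d)%N by apply: irr_degree_gt0.
(* [E] maps between the two copies one way and [F] the other; the upper left block is the identity
   in [E *m F] and 0 in [F *m E]. *)
pose E : 'M[algC]_(d + (d + e)) := block_mx 0 (row_mx 1%:M 0) 0 0.
pose F : 'M[algC]_(d + (d + e)) := block_mx 0 0 (col_mx 1%:M 0) 0.
(* [B] is square only up to the propositional equality [n_eq], so its inverse is taken as a
   pseudo-inverse. *)
have [C BC CB] : exists2 C : 'M_(d + (d + e), n), B *m C = 1%:M & C *m B = 1%:M.
  exists (pinvmx B); first exact: mulmxVp.
  by apply: mulVpmx; rewrite /row_full -[X in _ == X]n_eq.
have liftC (H : 'M[algC]_(d + (d + e))) :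
    (forall g, g \in G -> rD g *m H = H *m rD g) ->
    centralizes (B *m H *m C).
  move=> HG g gG; rewrite !mulmxA BG // -(mulmxA B (rD g)) HG // -!mulmxA.
  congr (_ *m (_ *m _)); rewrite /= -[RHS]mulmx1 -BC !mulmxA.
  by rewrite -(mulmxA _ (rG g)) BG // mulmxA CB mul1mx.
have cE := liftC E; have cF := liftC F.
have {cE}cE : centralizes (B *m E *m C).
  apply: cE => g gG; rewrite rDE /E !mulmx_block mul_row_block !mul_mx_row.
  by rewrite !(mulmx0, mul0mx, mulmx1, mul1mx, addr0, add0r, row_mx0, col_mx0).
have {cF}cF : centralizes (B *m F *m C).
  apply: cF => g gG; rewrite rDE /F !mulmx_block mul_block_col !mul_col_mx.
  by rewrite !(mulmx0, mul0mx, mulmx1, mul1mx, addr0, add0r, row_mx0, col_mx0).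
have EF : E *m F = F *m E.
  have reduce H K : C *m (B *m H *m C *m (B *m K *m C)) *m B = H *m K.
    rewrite !mulmxA CB mul1mx -(mulmxA _ C B) CB mulmx1.
    by rewrite -(mulmxA _ C B) CB mulmx1.
  by rewrite -(reduce E) cBC // reduce.
move/(congr1 ulsubmx): EF; rewrite /E /F !mulmx_block !block_mxKul.
rewrite mul_row_col !(mulmx0, mul0mx, mulmx1, addr0, add0r, row_mx0, col_mx0).
by move/matrixP/(_ (Ordinal d_gt0) (Ordinal d_gt0))/eqP; rewrite !mxE eqxx oner_eq0.
Qed.

(** Every multiplicity is 0 or 1, hence equal to its square. *)
Lemma card_irr_constt_norm :
    (forall B C, centralizes B -> centralizes C -> B *m C = C *m B) ->
  '[cfRepr rG] = #|irr_constt (cfRepr rG)|%:R.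
Proof.
move=> cBC; rewrite cfdot_sum_irr -sum1_card natr_sum [RHS]big_mkcond /=.
apply: eq_bigr => i _; rewrite irr_consttE.
have := multiplicity_le1 cBC i.
have /natrP[k ->] := Cnat_cfdot_char_irr i (cfRepr_char rG).
by rewrite lern1 conjC_nat; case: k => [|[|k]] //= _;
  rewrite ?mulr0 ?mulr1 ?eqxx ?oner_eq0.
Qed.

End MultiplicityFree.

(** * Submodules spanned by part of the standard basis *)

Section CoordinateSubmodule.
Variables (gT : finGroupType) (G : {group gT}) (n : nat).
Variables (rG : mx_representation algC G n) (P : pred 'I_n) (U : 'M[algC]_n).
Hypothesis defU : U = (\sum_(i < n | P i) <<delta_mx 0 i : 'rV_n>>)%MS.
Hypothesis Umod : mxmodule rG U.

(** The coordinate projection onto [U]; it turns inclusions in [U] into matrix equations. *)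
Let D : 'M[algC]_n := \matrix_(i, j) ((i == j) && P i)%:R.

Lemma mul_coord_diag m (B : 'M[algC]_(m, n)) :
  B *m D = \matrix_(i, j) (if P j then B i j else 0).
Proof.
apply/matrixP => i j; rewrite !mxE (bigD1 j) //= big1 => [|k /negPf kj].
  by rewrite !mxE eqxx /= addr0; case: ifP; rewrite ?mulr1 ?mulr0.
by rewrite !mxE kj mulr0.
Qed.

Lemma coord_diag_mul m (B : 'M[algC]_(n, m)) :
  D *m B = \matrix_(i, j) (if P i then B i j else 0).
Proof.
apply/matrixP => i j; rewrite !mxE (bigD1 i) //= big1 => [|k /negPf ki].
  by rewrite !mxE eqxx /= addr0; case: ifP; rewrite ?mul1r ?mul0r.
by rewrite !mxE eq_sym ki mul0r.
Qed.

Lemma sub_coord m (B : 'M[algC]_(m, n)) : (B <= U)%MS = (B *m D == B).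
Proof.
apply/idP/eqP => [BU|<-].
  have UD : U *m D = U.
    apply/eqP; rewrite -subr_eq0 -{2}[U]mulmx1 -mulmxBr.
    apply/eqP/sub_kermxP; rewrite defU; apply/sumsmx_subP => i Pi.
    rewrite genmxE; apply/sub_kermxP; rewrite mulmxBr mulmx1 mul_coord_diag.
    apply/eqP; rewrite subr_eq0; apply/eqP/matrixP => a j; rewrite !mxE.
    by have [->|_] := eqVneq j i; rewrite ?Pi // andbF if_same.
  by have /submxP[C ->] := BU; rewrite -mulmxA UD.
rewrite -[D]mul1mx mulmxA mul_coord_diag mulmx1.
apply/row_subP => i; rewrite [row i _]row_sum_delta; apply: summx_sub => j _.
rewrite !mxE; case: ifP => [Pj|_]; last by rewrite scale0r sub0mx.
apply: scalemx_sub; rewrite defU; apply: (sumsmx_sup j) => //.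
by rewrite genmxE.
Qed.

Let DrG g : g \in G -> D *m rG g *m D = D *m rG g.
Proof.
move=> gG; apply/eqP; rewrite -sub_coord (mxmodule_trans Umod) // sub_coord.
rewrite mul_coord_diag; apply/eqP/matrixP => i j; rewrite !mxE.
by case: eqP => [->|_]; case: (P j).
Qed.

(** [submod_repr] is written in an opaque basis of [U]; [B] and [C] compare it with the standard
    one. As [C *m B] is known to be the identity only on [U], the third identity carries a factor
    [D]. *)
Lemma coord_submod_factor : exists (B : 'M_(\rank U, n)) (C : 'M_(n, \rank U)),
  [/\ B *m D = B, B *m C = 1%:M, D *m C *m B = D &
     forall g, g \in G -> submod_repr Umod g = B *m rG g *m C].
Proof.
exists (val_submod 1%:M), (in_submod U 1%:M); split.
- by apply/eqP; rewrite -sub_coord val_submod1.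
- by rewrite -in_submodE val_submodK.
- rewrite -in_submodE -val_submodE in_submodK // sub_coord.
  rewrite mul_coord_diag; apply/eqP/matrixP => i j; rewrite !mxE.
  by case: eqP => [->|_]; case: (P j).
- by move=> g gG; rewrite /= /submod_mx in_submodE.
Qed.

Lemma coord_submod_trace g :
  g \in G -> \tr (submod_repr Umod g) = \sum_(i | P i) rG g i i.
Proof.
have [B [C [BD _ DCB rUE]]] := coord_submod_factor.
move=> gG; have -> : submod_repr Umod g = B *m (D *m rG g *m D *m C).
  by rewrite rUE // (DrG gG) !mulmxA BD.
rewrite mxtrace_mulC -!mulmxA (mulmxA D C) DCB !mulmxA.
rewrite (DrG gG) coord_diag_mul /mxtrace [RHS]big_mkcond /=.
by apply: eq_bigr => i _; rewrite mxE.
Qed.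

Hypothesis stableC : forall g i j, g \in G -> P j -> ~~ P i -> rG g i j = 0.

Let commD g : g \in G -> D *m rG g = rG g *m D.
Proof.
move=> gG; rewrite -(DrG gG) -mulmxA !mul_coord_diag coord_diag_mul.
apply/matrixP => i j; rewrite !mxE; case: ifP => // Pi.
by case: ifP => // Pj; rewrite stableC ?Pi.
Qed.

(** The complementary coordinates are stable too, so the projection commutes with the group, and an
    endomorphism of the submodule extended by zero centralizes the whole representation. *)
Lemma coord_submod_comm :
    (forall B C, centralizes rG B -> centralizes rG C ->
       (forall i j, ~~ P i || ~~ P j -> B i j = 0) ->
       (forall i j, ~~ P i || ~~ P j -> C i j = 0) -> B *m C = C *m B) ->
  forall B C, centralizes (submod_repr Umod) B ->
    centralizes (submod_repr Umod) C -> B *m C = C *m B.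
Proof.
have [Bv [Cv [BvD BvCv DCvBv rUE]]] := coord_submod_factor.
move=> cBC B C cB cC; pose lift E := D *m Cv *m E *m Bv.
have BvG g : g \in G -> Bv *m rG g = submod_repr Umod g *m Bv.
  move=> gG; rewrite rUE // -{2}BvD -(mulmxA Bv D) (commD gG) -!mulmxA.
  by rewrite (mulmxA D Cv) DCvBv -(commD gG) mulmxA BvD.
have CvG g : g \in G -> rG g *m (D *m Cv) = D *m Cv *m submod_repr Umod g.
  move=> gG; rewrite rUE // !mulmxA DCvBv.
  by rewrite (commD gG).
have liftP E : centralizes (submod_repr Umod) E -> centralizes rG (lift E).
  move=> cE g gG; move: (CvG g gG) (BvG g gG) (cE g gG).
  move: (submod_repr Umod g) => r Cr Br Er.
  rewrite /lift !mulmxA -(mulmxA _ D) Cr -!mulmxA Br !mulmxA.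
  by rewrite -(mulmxA _ r) Er !mulmxA.
have lift0 E i j : ~~ P i || ~~ P j -> lift E i j = 0.
  have -> : lift E = D *m lift E *m D.
    rewrite /lift -!mulmxA BvD !mulmxA; congr (_ *m _ *m _ *m _).
    by rewrite coord_diag_mul; apply/matrixP => a b; rewrite !mxE andbC; case: (P a);
      rewrite ?andbF.
  by rewrite coord_diag_mul mul_coord_diag !mxE; case: (P i); case: (P j).
have liftM E F : lift E *m lift F = lift (E *m F).
  rewrite /lift -!mulmxA; congr (_ *m (_ *m (_ *m _))).
  by rewrite (mulmxA Bv) BvD (mulmxA Bv) BvCv mul1mx.
have liftK E : Bv *m lift E *m Cv = E.
  by rewrite /lift !mulmxA BvD BvCv mul1mx -mulmxA BvCv mulmx1.
by rewrite -[LHS]liftK -[RHS]liftK -!liftM cBC //; apply: liftP || apply: lift0.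
Qed.

End CoordinateSubmodule.

Lemma card_const_fibres (S T : finType) (f : S -> T) (D : {set S}) k :
    (forall t, t \in D -> #|[set s in D | f s == f t]| = k) ->
  #|D| = (k * #|f @: D|)%N.
Proof.
move=> fibre; rewrite -sum1_card (partition_big_imset f) /=.
rewrite mulnC -sum_nat_const; apply: eq_bigr => _ /imsetP[t tD ->].
by rewrite -(fibre t tD) -sum1_card; apply: eq_bigl => s; rewrite inE.
Qed.

(** * Squares and binary quadratic forms over a finite field of odd characteristic *)

Section FiniteFieldSquares.
Variable F : finFieldType.
Hypothesis two_neq0 : 2 != 0 :> F.

(** Squaring is 2-to-1 on nonzero elements, and 0 adds one more square. *)
Lemma card_squares : (#|F| < 2 * #|[set s ^+ 2 | s : F]|)%N.
Proof.
have sub : 0 |: [set s ^+ 2 | s in [set s : F | s != 0]] \subset [set s ^+ 2 | s : F].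
  apply/subsetP=> _ /setU1P[->|/imsetP[s _ ->]]; last by apply: imset_f.
  by apply/imsetP; exists 0; rewrite ?expr0n.
apply: leq_trans (leq_mul (leqnn 2) (subset_leq_card sub)).
rewrite cardsU1; have -> : 0 \notin [set s ^+ 2 | s in [set s : F | s != 0]].
  by apply/imsetP => -[s]; rewrite inE => nz /eqP; rewrite eq_sym expf_eq0 (negPf nz).
rewrite mulnDr muln1 -(@card_const_fibres _ _ (fun s : F => s ^+ 2) _ 2); last first.
  move=> t; rewrite inE => nz; have t_neq : t != - t.
    by rewrite -addr_eq0 -mulr2n -mulr_natr mulf_neq0.
  transitivity #|[set t; - t]|; last by rewrite cards2 t_neq.
  apply: eq_card => s; rewrite !inE eqf_sqr; apply: andb_idl.
  by case/orP => /eqP->; rewrite ?oppr_eq0.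
have -> : [set s : F | s != 0] = [set~ 0] by apply/setP=> s; rewrite !inE.
by rewrite cardsC1 (cardD1 0).
Qed.

(** Pigeonhole: a s^2 and c - b t^2 each take more than half of the values in F, so they meet. *)
Lemma binary_form_universal (a b c : F) : a != 0 -> b != 0 ->
  exists s t, a * s ^+ 2 + b * t ^+ 2 = c.
Proof.
move=> a0 b0; pose Q := [set s ^+ 2 | s : F].
pose A := [set a * s | s in Q]; pose B := [set c - b * s | s in Q].
have cA : #|A| = #|Q| by apply: card_imset; apply: mulfI.
have cB : #|B| = #|Q|.
  by apply: card_imset => s t /addrI/oppr_inj; apply: mulfI.
have : A :&: B != set0.
  apply/eqP => AB0; have := cardsUI A B; rewrite AB0 cards0 addn0 cA cB addnn -mul2n => e.
  by have := card_squares; rewrite -/Q -e ltnNge max_card.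
case/set0Pn => e /setIP[/imsetP[_ /imsetP[s _ ->] ->] /imsetP[_ /imsetP[t _ ->]]].
by move/eqP; rewrite eq_sym subr_eq => /eqP ->; exists s, t.
Qed.

End FiniteFieldSquares.

(* The properties of A that matter: a finite local principal ring with maximal
   ideal Ay of nilpotency degree 2l and residue map res, with an involution
   that negates y and is trivial on the residue field. *)
Record ramified_ring (A : finComNzRingType) (F : finFieldType) (conj : A -> A)
    (y : A) (res : {rmorphism A -> F}) (l p : nat) : Prop := RamifiedRing {
  conjD : {morph conj : a b / a + b};
  conjM : {morph conj : a b / a * b};
  conjK : involutive conj;
  conj_y : conj y = - y;
  res_surj : forall c, exists a, res a = c;
  res_eq0P : forall a, res a = 0 <-> exists b, a = y * b;
  res_conj : forall a, res (conj a) = res a;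
  y_nilp : y ^+ (l + l) = 0;
  y_last : y ^+ (l + l).-1 != 0;
  l_pos : (0 < l)%N;
  odd_pchar : odd p;
  pcharA : p \in [pchar A]
}.

(** * Arithmetic of A: units, powers of y, square roots, norm 1 elements *)

Section RamifiedRing.
Variables (A : finComNzRingType) (F : finFieldType) (conj : A -> A) (y : A).
Variables (res : {rmorphism A -> F}) (l p : nat).
Hypothesis rr : ramified_ring conj y res l p.
Implicit Types a b c r s : A.

Lemma conj0 : conj 0 = 0.
Proof. by apply: (addrI (conj 0)); rewrite -(conjD rr) !addr0. Qed.

Lemma conjN a : conj (- a) = - conj a.
Proof. by apply: (addrI (conj a)); rewrite -(conjD rr) !subrr conj0. Qed.

Lemma conjB a b : conj (a - b) = conj a - conj b.
Proof. by rewrite (conjD rr) conjN. Qed.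

Lemma conj1 : conj 1 = 1.
Proof. by have := conjM rr (conj 1) 1; rewrite mulr1 (conjK rr) mul1r. Qed.

Lemma conjX a n : conj (a ^+ n) = conj a ^+ n.
Proof. by elim: n => [|n IHn]; rewrite ?conj1 // !exprS (conjM rr) IHn. Qed.

Lemma conjMn a n : conj (a *+ n) = conj a *+ n.
Proof. by elim: n => [|n IHn]; rewrite ?conj0 // !mulrS (conjD rr) IHn. Qed.

Lemma conj_yX n : conj (y ^+ n) = (-1) ^+ n * y ^+ n.
Proof. by rewrite conjX (conj_y rr) -[- y]mulN1r exprMn. Qed.

Lemma conj_norm a : conj (a * conj a) = a * conj a.
Proof. by rewrite (conjM rr) (conjK rr) mulrC. Qed.

Lemma conj_inv a b : conj a = a -> a * b = 1 -> conj b = b.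
Proof.
move=> ca ab; have ab' : a * conj b = 1 by rewrite -{1}ca -(conjM rr) ab conj1.
by rewrite -[LHS]mulr1 -ab mulrA [conj b * a]mulrC ab' mul1r.
Qed.

Lemma res_y b : res (y * b) = 0.
Proof. by apply/(res_eq0P rr); exists b. Qed.

Lemma y_nilpX n : (l + l <= n)%N -> y ^+ n = 0.
Proof. by move/subnK => <-; rewrite exprD (y_nilp rr) mulr0. Qed.

Lemma half_two : (p.+1./2)%:R * 2 = 1 :> A.
Proof.
rewrite -natrM muln2 -[_.*2]add0n -[0%N]/(nat_of_bool false).
have -> : false = odd p.+1 by rewrite /= (odd_pchar rr).
by rewrite odd_double_half -add1n natrD (pcharf0 (pcharA rr)) addr0.
Qed.

Lemma res_two : 2 != 0 :> F.
Proof.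
apply/eqP => two0; have := congr1 res half_two.
by rewrite rmorphM rmorph1 (rmorph_nat res 2) two0 mulr0 => /eqP; rewrite eq_sym oner_eq0.
Qed.

Lemma res_inv a : res a != 0 -> exists b, a * b = 1.
Proof.
move=> ra; have [b rb] := res_surj rr (res a)^-1.
have : res (1 - a * b) = 0 by rewrite rmorphB rmorph1 rmorphM rb mulfV ?subrr.
(* 1 - yc is inverted by its geometric series, finite because y is nilpotent. *)
case/(res_eq0P rr) => c Dc; exists (b * \sum_(i < l + l) (y * c) ^+ i).
have -> : a * (b * \sum_(i < l + l) (y * c) ^+ i) =
    (1 - y * c) * \sum_(i < l + l) (y * c) ^+ i.
  by rewrite -Dc subKr mulrA.
by rewrite -[X in X * _]opprB mulNr -subrX1 exprMn (y_nilp rr) mul0r sub0r opprK.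
Qed.

Lemma res_inv_neq0 a b : a * b = 1 -> res a != 0.
Proof.
by move/(congr1 res); rewrite rmorphM rmorph1; apply: contra_eq_neq => ->;
  rewrite mul0r eq_sym oner_neq0.
Qed.

Lemma y_factor a n : (exists k u, [/\ (k < n)%N, res u != 0 & a = y ^+ k * u]) \/
  exists b, a = y ^+ n * b.
Proof.
elim: n => [|n [[k [u [kn ru Da]]]|[b Db]]]; first by right; exists a; rewrite mul1r.
  by left; exists k, u; rewrite ltnS ltnW.
have [rb|rb] := eqVneq (res b) 0; last by left; exists n, b.
by have [c Dc] := (res_eq0P rr b).1 rb; right; exists c; rewrite exprSr -mulrA -Dc.
Qed.

(** If a were y^j times a unit with j < 2l - k, then y^(k+j) = 0 with k + j at most 2l - 1, against
    [y_last]. For k = l this says that y^l a determines a modulo i and nothing more. *)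
Lemma yX_eq0 k a : (k <= l + l)%N ->
  y ^+ k * a = 0 <-> exists b, a = y ^+ (l + l - k) * b.
Proof.
move=> kl; split=> [yka|[b ->]]; last by rewrite mulrA -exprD subnKC // (y_nilp rr) mul0r.
have [[j [u [jk ru Da]]]|//] := y_factor a (l + l - k).
have [v uv] := res_inv ru; case/negP: (y_last rr); apply/eqP.
have ykj : y ^+ (k + j) = 0.
  by rewrite exprD -[LHS]mulr1 -uv mulrA -(mulrA _ _ u) -Da yka mul0r.
have kjl : (k + j <= (l + l).-1)%N.
  by rewrite ltn_subRL in jk; rewrite -ltnS prednK // (leq_ltn_trans _ jk).
by rewrite -(subnK kjl) exprD ykj mulr0.
Qed.

Lemma yX_unit k a : (k < l + l)%N -> res a != 0 -> y ^+ k * a != 0.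
Proof.
move=> kl ra; apply/eqP => /(yX_eq0 _ (ltnW kl))[b Db]; case/negP: ra.
by rewrite Db -[(_ - _)%N]prednK ?subn_gt0 // exprS -mulrA res_y.
Qed.

(* Units congruent to 1 mod y have p-power order, and p is odd. *)
Lemma exists_sqrt r : conj r = r -> res r = 1 ->
  exists s, [/\ conj s = s, res s = 1 & s ^+ 2 = r].
Proof.
move=> cr r1; pose P := (p ^ (l + l))%N.
have pr_p : prime p := pcharf_prime (pcharA rr).
have rP : r ^+ P = 1.
  have : res (r - 1) = 0 by rewrite rmorphB rmorph1 r1 subrr.
  case/(res_eq0P rr) => b Db; rewrite -[r](subrK 1) Db GRing.exprDn_pchar.
    by rewrite expr1n exprMn y_nilpX ?mul0r ?add0r // ltnW // ltn_expl ?prime_gt1.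
  by rewrite (eq_pnat _ (pcharf_eq (pcharA rr))) pnatX pnat_id.
exists (r ^+ P.+1./2); rewrite conjX cr rmorphXn r1 expr1n -exprM muln2; split=> //.
have oP : odd P by rewrite oddX (odd_pchar rr) orbT.
have -> : (P.+1./2.*2 = P.+1)%N by rewrite -[RHS]odd_double_half /= oP.
by rewrite exprS rP mulr1.
Qed.

(** Divide a by the fixed square root s of a a^* with residue 1. The change is in i, because s^2 - 1
    is and s + 1 is a unit. *)
Lemma norm_one_lift a : y ^+ l * (a * conj a - 1) = 0 ->
  exists b, b * conj b = 1 /\ y ^+ l * (b - a) = 0.
Proof.
move=> a1; have [b Db] := (yX_eq0 _ (leq_addr l l)).1 a1; rewrite addnK in Db.
have r1 : res (a * conj a) = 1.
  rewrite -[a * _](subrK 1) Db -(prednK (l_pos rr)) exprS -mulrA rmorphD res_y.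
  by rewrite add0r rmorph1.
have [s [cs rs s2]] := exists_sqrt (conj_norm a) r1.
have [t st] : exists t, s * t = 1 by apply: res_inv; rewrite rs oner_neq0.
have ct := conj_inv cs st.
have [v sv] : exists v, (s + 1) * v = 1.
  by apply: res_inv; rewrite rmorphD rs rmorph1 -[_ + _]/(2 : F) res_two.
exists (a * t); rewrite (conjM rr) ct; split.
  by rewrite mulrACA -s2 expr2 mulrACA st mulr1.
have -> : a * t - a = - (a * t * (s - 1) * ((s + 1) * v)).
  by rewrite sv mulr1 -[X in _ - X]mulr1 -[X in _ - _ * X]st; ring.
have -> : a * t * (s - 1) * ((s + 1) * v) = (a * conj a - 1) * (a * t * v).
  by rewrite -s2; ring.
by rewrite mulrN (mulrA (y ^+ l)) a1 mul0r oppr0.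
Qed.

End RamifiedRing.

(* Freeness of V enters only through [y_torsion]. *)
Record hermitian_space (A : finComNzRingType) (conj : A -> A) (y : A) (l : nat)
    (V : finLmodType A) (h : V -> V -> A) : Prop := HermitianSpace {
  formDl : forall u v w, h (u + v) w = h u w + h v w;
  formDr : forall u v w, h u (v + w) = h u v + h u w;
  formZr : forall a u v, h u (a *: v) = a * h u v;
  formC : forall u v, h v u = conj (h u v);
  form_nondeg : forall v, (forall u, h u v = 0) -> v = 0;
  y_torsion : forall k v, (k <= l + l)%N -> y ^+ k *: v = 0 ->
    exists w : V, v = y ^+ (l + l - k) *: w
}.

(** * Isometries and Witt's theorem *)

Section HermitianSpace.
Variables (A : finComNzRingType) (F : finFieldType) (conj : A -> A) (y : A).
Variables (res : {rmorphism A -> F}) (l p : nat).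
Hypothesis rr : ramified_ring conj y res l p.
Variables (V : finLmodType A) (h : V -> V -> A).
Hypothesis hs : hermitian_space conj y l h.
Implicit Types (a b c : A) (u v w : V).

(** By [y_torsion], vanishing here means that v lies in yV. In this form invariance under isometries
    and under congruence modulo iV is immediate. *)
Definition prim_vec v : bool := y ^+ (l + l).-1 *: v != 0.

Definition isometry_of (f : V -> V) : Prop :=
  (forall a u v, f (a *: u + v) = a *: f u + f v) /\
  (forall u v, h (f u) (f v) = h u v).

Lemma formZl a u v : h (a *: u) v = conj a * h u v.
Proof. by rewrite (formC hs v) (formZr hs) (conjM rr) -(formC hs). Qed.

Lemma form0r u : h u 0 = 0.
Proof. by rewrite -[0 in LHS](scale0r 0) (formZr hs) mul0r. Qed.

Lemma formNr u v : h u (- v) = - h u v.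
Proof. by rewrite -scaleN1r (formZr hs) mulN1r. Qed.

Lemma formNl u v : h (- u) v = - h u v.
Proof. by rewrite (formC hs v) formNr (conjN rr) -(formC hs). Qed.

Lemma form_self v : conj (h v v) = h v v.
Proof. by rewrite -(formC hs). Qed.

(** If no h(u, v) were a unit, y^(2l-1) v would be orthogonal to all of V, hence zero. *)
Lemma prim_dual v : prim_vec v -> exists u, h u v = 1.
Proof.
move=> pv; have [/existsP[u ru]|/existsPn r0] := boolP [exists u, res (h u v) != 0].
  have [a ua] := res_inv rr ru; exists (conj a *: u).
  by rewrite formZl (conjK rr) mulrC.
case/eqP: pv; apply: (form_nondeg hs) => u; rewrite (formZr hs).
have /eqP/(res_eq0P rr)[b ->] := negPn (r0 u).
rewrite mulrA -exprSr prednK ?(y_nilp rr) ?mul0r //.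
by rewrite addn_gt0 (l_pos rr).
Qed.

Lemma prim_of_dual u v : res (h u v) != 0 -> prim_vec v.
Proof.
move=> ruv; apply/eqP => yv; have: h u (y ^+ (l + l).-1 *: v) = 0 by rewrite yv form0r.
rewrite (formZr hs); apply/eqP; apply: (yX_unit rr) => //.
by rewrite prednK ?leqnn // addn_gt0 (l_pos rr).
Qed.

Lemma isometry_comp f g : isometry_of f -> isometry_of g -> isometry_of (f \o g).
Proof. by move=> [fl fh] [gl gh]; split=> *; rewrite /= ?gl ?fl // fh gh. Qed.

Lemma isometry_perm f : isometry_of f ->
  exists2 g : {perm V}, g =1 f & isometry_of g.
Proof.
move=> [fl fh]; have fB u v : f (u - v) = f u - f v.
  by have := fl (-1) v u; rewrite !scaleN1r ![- _ + _]addrC.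
have injf : injective f.
  move=> u v /eqP; rewrite -subr_eq0 -fB => /eqP fuv.
  apply/eqP; rewrite -subr_eq0; apply/eqP/(form_nondeg hs) => w.
  by rewrite -fh fuv form0r.
exists (perm injf) => [u|]; first by rewrite permE.
by split=> *; rewrite !permE ?fl ?fh.
Qed.

Lemma isometry_scale a : a * conj a = 1 -> isometry_of (fun v => a *: v).
Proof.
move=> a1; split=> [b u v|u v]; first by rewrite scalerDr !scalerA mulrC.
by rewrite formZl (formZr hs) mulrA [conj a * a]mulrC a1 mul1r.
Qed.

(* The elements 1 + z of U with z skew-hermitian of rank 2 and values in iV. *)
Lemma isometry_congruence c u u' : (exists b, c = y ^+ l * b) ->
  isometry_of (fun t => t + (c * h u' t) *: u - (conj c * h u t) *: u').
Proof.
case=> b Dc; have Dc' : conj c = y ^+ l * ((-1) ^+ l * conj b).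
  by rewrite Dc (conjM rr) (conj_yX rr); ring.
have yy : y ^+ l * y ^+ l = 0 by rewrite -exprD (y_nilp rr).
have cc : c * c = 0 by rewrite Dc mulrACA yy mul0r.
have cd : c * conj c = 0 by rewrite Dc' Dc mulrACA yy mul0r.
have dd : conj c * conj c = 0 by rewrite Dc' mulrACA yy mul0r.
split=> [a s t|s t].
  rewrite !(formDr hs) !(formZr hs) !mulrDr !(mulrCA _ a) !scalerDl -!(scalerA a).
  by rewrite scalerBr scalerDr opprD [X in X + _ = _]addrACA [LHS]addrACA.
rewrite !(formDr hs) !formNr !(formDl hs) !formNl !formZl !(formZr hs).
rewrite !(conjM rr) (conjK rr) -!(formC hs).
(* The terms linear in c and c^* cancel by skewness; those left carry a product of two elements of
   i, which is zero. *)
transitivity (h s t + (c * conj c) * (h s u' * h u u * h u' t)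
  + (c * conj c) * (h s u * h u' u' * h u t)
  - (c * c) * (h s u * h u' u * h u' t)
  - (conj c * conj c) * (h s u' * h u u' * h u t)); first by ring.
by rewrite cc cd dd !mul0r !subr0 !addr0.
Qed.

(** With e = v - w, the map t -> t - h(e, v)^-1 h(e, t) e sends v to w. It preserves h because h(e,
    e) = h(e, v) + h(e, v)^*, which is where the equal lengths of v and w enter. *)
Lemma isometry_reflection v w : h v v = h w w -> res (h (v - w) v) != 0 ->
  exists2 f, isometry_of f & f v = w.
Proof.
move=> vw; set e := v - w => rev; have [c ec] := res_inv rr rev.
have hee : h e e = h e v + conj (h e v).
  rewrite -(formC hs) {2}/e (formDr hs) formNr; congr (_ + _).
  by rewrite /e !(formDr hs) !(formDl hs) !formNr !formNl vw; ring.
have Dw : v - e = w by rewrite /e opprB addrC subrK.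
clearbody e; have ec' : conj (h e v) * conj c = 1 by rewrite -(conjM rr) ec (conj1 rr).
exists (fun t => t - (c * h e t) *: e); last first.
  by rewrite mulrC ec scale1r.
split=> [a s t|s t].
  rewrite (formDr hs) (formZr hs) mulrDr mulrCA scalerDl -(scalerA a).
  by rewrite opprD [LHS]addrACA -scalerBr.
rewrite !(formDr hs) !formNr !(formDl hs) !formNl !formZl !(formZr hs).
rewrite (conjM rr) -(formC hs) hee.
transitivity (h s t + h s e * h e t *
   (c * (conj (h e v) * conj c) + conj c * (h e v * c) - conj c - c)); first by ring.
by rewrite ec ec'; ring.
Qed.

(** For t = r d with r fixed and d inverse to h(u, v), the equation becomes n r^2 + 2r + g = 0. Its
    reduced discriminant 1 - ng has residue 1, hence a fixed square root. *)
Lemma form_scaled_shift v u s : res (h v v) = 0 -> res (h u v) != 0 -> conj s = s ->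
  exists t, h (u + t *: v) (u + t *: v) = s.
Proof.
move=> rv ruv cs; have [d kd] := res_inv rr ruv.
pose n := d * conj d * h v v; pose g := h u u - s.
have cn : conj n = n by rewrite /n (conjM rr) (conj_norm rr) form_self.
have cg : conj g = g by rewrite /g (conjB rr) form_self cs.
have [rho [crho rrho rho2]] : exists r, [/\ conj r = r, res r = 1 & r ^+ 2 = 1 - n * g].
  apply: (exists_sqrt rr); first by rewrite (conjB rr) (conj1 rr) (conjM rr) cn cg.
  by rewrite rmorphB rmorph1 /n !rmorphM rv mulr0 mul0r subr0.
have [i rhoi] : exists i, (1 + rho) * i = 1.
  by apply: (res_inv rr); rewrite rmorphD rrho rmorph1 -[_ + _]/(2 : F) (res_two rr).
have ci : conj i = i.
  by apply: (conj_inv rr _ rhoi); rewrite (conjD rr) (conj1 rr) crho.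
(* The root (-1 + rho)/n is rationalized to -g/(1 + rho), since n is not a unit. *)
pose r := - (g * i); have cr : conj r = r by rewrite (conjN rr) (conjM rr) cg ci.
have quad : n * r ^+ 2 + 2 * r + g = 0.
  transitivity (g * i ^+ 2 * (n * g - 1 + rho ^+ 2) - g * (2 * i * (1 - (1 + rho) * i)
     + ((1 + rho) * i) ^+ 2 - 1)); first by rewrite /r; ring.
  by rewrite rho2 rhoi; ring.
exists (r * d); rewrite !(formDr hs) !(formDl hs) !formZl !(formZr hs).
rewrite !(conjM rr) cr [h v u](formC hs).
have kd' : conj (h u v) * conj d = 1 by rewrite -(conjM rr) kd (conj1 rr).
apply/eqP; rewrite -subr_eq0; apply/eqP; rewrite -quad.
transitivity (n * r ^+ 2 + g + r * (h u v * d) + r * (conj (h u v) * conj d)).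
  by rewrite /n /g; ring.
by rewrite kd kd'; ring.
Qed.

Lemma common_dual v w : prim_vec v -> prim_vec w ->
  exists u, res (h u v) != 0 /\ res (h u w) != 0.
Proof.
move=> /prim_dual[u1 u1v] /prim_dual[u2 u2w].
have [r1|r1] := eqVneq (res (h u1 w)) 0; last first.
  by exists u1; rewrite u1v rmorph1 oner_neq0.
have [r2|r2] := eqVneq (res (h u2 v)) 0; last first.
  by exists u2; rewrite u2w rmorph1 oner_neq0.
exists (u1 + u2); rewrite !(formDl hs) !rmorphD u1v u2w r1 r2 addr0 add0r.
by rewrite rmorph1 oner_neq0.
Qed.

(* Witt's theorem for primitive vectors: one or two quasi-reflections. *)
Lemma isometry_transitive v w : prim_vec v -> prim_vec w -> h v v = h w w ->
  exists2 f, isometry_of f & f v = w.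
Proof.
move=> pv pw vw.
have [r1|] := eqVneq (res (h (v - w) v)) 0; last exact: isometry_reflection.
have [rv|rv] := eqVneq (res (h v v)) 0; last first.
  (* Here h(w, v) and h(v, v) have the same residue, so h(v + w, v) has residue twice that of h(v,
     v), which is nonzero: reflect v to -w and change sign. *)
  have [||f fI fv] := @isometry_reflection v (- w).
  - by rewrite formNl formNr opprK.
  - have /eqP : res (h v v) - res (h w v) = 0.
      by rewrite -rmorphB -formNl -(formDl hs).
    rewrite subr_eq0 opprK (formDl hs) rmorphD => /eqP <-.
    by rewrite -mulr2n -mulr_natr mulf_neq0 ?(res_two rr).
  exists ( *:%R (-1) \o f); last by rewrite /= fv scaleN1r opprK.
  by apply: isometry_comp fI; apply: isometry_scale;
    rewrite (conjN rr) (conj1 rr) mulrNN mulr1.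
have rwv : res (h w v) = 0.
  by move: r1; rewrite (formDl hs) formNl rmorphB rv sub0r => /eqP;
    rewrite oppr_eq0 => /eqP.
have rvw : res (h v w) = 0 by rewrite (formC hs) (res_conj rr).
(* Now h(v, v), h(w, w) and h(v, w) are all non-units. The detour goes through a vector v' of the
   same length whose pairings with v and with w are units. *)
have [u [ruv ruw]] := common_dual pv pw.
have [t ht] := form_scaled_shift rv ruv (form_self v).
set v' := u + t *: v in ht; have rv'v : res (h v' v) != 0.
  by rewrite (formDl hs) formZl rmorphD rmorphM rv mulr0 addr0.
have rv'w : res (h v' w) != 0.
  by rewrite (formDl hs) formZl rmorphD rmorphM rvw mulr0 addr0.
have [||f fI fv] := @isometry_reflection v v'; first by rewrite ht.
  by rewrite (formDl hs) formNl rmorphB rv sub0r oppr_eq0.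
have [||g gI gv] := @isometry_reflection v' w; first by rewrite ht.
  rewrite (formDl hs) formNl rmorphB ht rv sub0r oppr_eq0.
  by rewrite (formC hs) (res_conj rr).
by exists (g \o f); [apply: isometry_comp | rewrite /= fv].
Qed.

Lemma congr_form_self v w : y ^+ l *: (v - w) = 0 -> y ^+ l * h v v = y ^+ l * h w w.
Proof.
have [d Dv] : {d | v - w = d} by exists (v - w).
rewrite Dv => yd; have -> : v = w + d by rewrite -Dv addrC subrK.
have hd u : y ^+ l * h u d = 0 by rewrite -(formZr hs) yd form0r.
have hd' : y ^+ l * h d w = 0.
  apply: (can_inj (conjK rr)); rewrite (conj0 rr) (conjM rr) (conj_yX rr).
  by rewrite -(formC hs) -mulrA hd mulr0.
by rewrite !(formDr hs) !(formDl hs) !mulrDr !hd hd' !addr0.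
Qed.

(** Move w within its class to w + cu, where u is dual to w and c is half the difference d of the
    lengths. As d is in i, c^2 = 0, so the length of w + cu is exactly that of v and Witt's theorem
    applies. *)
Lemma isometry_transitive_congr v w : prim_vec v -> prim_vec w ->
    y ^+ l * h v v = y ^+ l * h w w ->
  exists2 g : {perm V}, isometry_of g & y ^+ l *: (g v - w) = 0.
Proof.
move=> pv pw /eqP; rewrite -subr_eq0 -mulrBr => /eqP yd.
have [u uw] := prim_dual pw; pose d := h v v - h w w; pose c := (p.+1./2)%:R * d.
have cd : conj d = d by rewrite (conjB rr) !form_self.
have cc : conj c = c by rewrite (conjM rr) cd (conjMn rr) (conj1 rr).
have d2 : c * c = 0.
  have [b Db] := (yX_eq0 rr d (leq_addr l l)).1 yd; rewrite addnK in Db.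
  by rewrite /c mulrACA [d * d](_ : _ = 0) ?mulr0 // {1}Db mulrAC yd mul0r.
have yc : y ^+ l * c = 0 by rewrite /c mulrCA yd mulr0.
pose w' := w + c *: u; have hw' : h v v = h w' w'.
  rewrite /w' !(formDr hs) !(formDl hs) !formZl !(formZr hs) cc.
  rewrite [h w u](formC hs) uw (conj1 rr).
  transitivity (h w w + (p.+1./2)%:R * 2 * d + c * c * h u u).
    by rewrite d2 (half_two rr) /d; ring.
  by rewrite /c; ring.
have pw' : prim_vec w'.
  apply: (@prim_of_dual u); rewrite (formDr hs) (formZr hs) uw rmorphD rmorphM.
  have /eqP : res c * res c = 0 by rewrite -rmorphM d2 rmorph0.
  by rewrite mulf_eq0 orbb => /eqP ->; rewrite mul0r addr0 rmorph1 oner_neq0.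
have [f fI fv] := isometry_transitive pv pw' hw'.
have [g gf gI] := isometry_perm fI; exists g => //.
by rewrite gf fv /w' addrC addKr scalerA yc scale0r.
Qed.

End HermitianSpace.

(** * The characters of the congruence subgroup modulo i *)

Record weil_character (A : finComNzRingType) (conj : A -> A) (mu : A -> algC) :
    Prop := WeilCharacter {
  muD : {morph mu : a b / a + b >-> a * b};
  mu0 : mu 0 = 1;
  mu_self : forall a, conj a = a -> mu a = 1;
  mu_faithful : forall a, (forall b, mu (b * a) = 1) -> a = 0
}.

Section CongruenceCharacters.
Variables (A : finComNzRingType) (F : finFieldType) (conj : A -> A) (y : A).
Variables (res : {rmorphism A -> F}) (l p : nat).
Hypothesis rr : ramified_ring conj y res l p.
Variables (V : finLmodType A) (h : V -> V -> A).
Hypothesis hs : hermitian_space conj y l h.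
Variable mu : A -> algC.
Hypothesis mc : weil_character conj mu.
Implicit Types (a b c : A) (u v w : V).

Lemma mu_neq0 a : mu a != 0.
Proof.
apply/eqP => mua; have := mu0 mc; rewrite -(subrr a) (muD mc) mua mul0r.
by move/eqP; rewrite eq_sym oner_eq0.
Qed.

Lemma muN a : mu (- a) = (mu a)^-1.
Proof.
by apply: (mulfI (mu_neq0 a)); rewrite -(muD mc) subrr (mu0 mc) mulfV ?mu_neq0.
Qed.

Lemma mu_skew b : mu (conj b - b) = mu (- (2 * b)).
Proof.
have -> : conj b - b = (conj b + b) + - (2 * b) by ring.
rewrite (muD mc) (mu_self mc) ?mul1r //.
by rewrite (conjD rr) (conjK rr) addrC.
Qed.

(** On the congruence isometry with parameter c, the character of v is mu(-2c h(v, u) h(u', v)).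
    Letting c run over i, faithfulness of mu recovers h(v, u) h(u', v) modulo i. *)
Lemma mu_congr_eq v w u u' :
    (forall g : {perm V}, isometry_of h g ->
       (forall t, y ^+ l *: (g t - t) = 0) ->
       mu (h (g v) v) = mu (h (g w) w)) ->
  y ^+ l * (h v u * h u' v) = y ^+ l * (h w u * h u' w).
Proof.
move=> eq_mu; apply/eqP; rewrite -subr_eq0 -mulrBr; apply/eqP.
(* The factor 1/2 absorbs the 2 produced by [mu_skew]. *)
apply: (mu_faithful mc) => b; have [c Dc] : {c | c = y ^+ l * ((p.+1./2)%:R * b)} by
  eexists.
have [d Dd] : exists d, conj c = y ^+ l * d.
  by exists ((-1) ^+ l * conj ((p.+1./2)%:R * b)); rewrite Dc (conjM rr (y ^+ l))
    (conj_yX rr); ring.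
have yy : y ^+ l * y ^+ l = 0 by rewrite -exprD (y_nilp rr).
have [g gE gI] := isometry_perm hs (isometry_congruence rr hs u u' (ex_intro _ _ Dc)).
have gval t : mu (h (g t) t) = mu (- (2 * (c * (h t u * h u' t)))).
  rewrite gE !(formDl hs) (formNl rr hs) !(formZl rr hs) !(conjM rr) (conjK rr).
  rewrite -!(formC hs) -addrA (muD mc) (mu_self mc) ?mul1r ?(form_self hs) //.
  rewrite -mu_skew !(conjM rr) -!(formC hs); congr mu.
  by ring.
have yg t : y ^+ l *: (g t - t) = 0.
  rewrite gE Dd Dc addrAC [t + _]addrC addrK.
  by rewrite scalerBr !scalerA !mulrA yy !mul0r !scale0r subrr.
have := eq_mu g gI yg; rewrite !gval !muN => /invr_inj e.
have -> : b * (y ^+ l * (h v u * h u' v - h w u * h u' w)) =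
    2 * (c * (h v u * h u' v)) - 2 * (c * (h w u * h u' w)).
  transitivity ((p.+1./2)%:R * 2 * (b * (y ^+ l * (h v u * h u' v - h w u * h u' w)))).
    by rewrite (half_two rr) mul1r.
  by rewrite Dc; ring.
by rewrite (muD mc) muN e mulfV ?mu_neq0.
Qed.

(* Equality of the characters forces v v* = w w* mod i; pairing with a dual
   vector of v turns this into proportionality. *)
Lemma congr_characters_separate v w : prim_vec y l v ->
    (forall g : {perm V}, isometry_of h g ->
       (forall t, y ^+ l *: (g t - t) = 0) ->
       mu (h (g v) v) = mu (h (g w) w)) ->
  exists a, a * conj a = 1 /\ y ^+ l *: (w - a *: v) = 0.
Proof.
move=> pv eq_mu; have [u uv] := prim_dual rr hs pv.
have vu : h v u = 1 by rewrite (formC hs) uv (conj1 rr).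
(* The only candidate: w = av would give h(u, w) = a. It has norm 1 only modulo i, whence
   [norm_one_lift] below. *)
pose a := h u w; have wu : h w u = conj a by rewrite (formC hs).
have ya u' : y ^+ l * h u' v = y ^+ l * (conj a * h u' w).
  by have := mu_congr_eq u u' eq_mu; rewrite vu mul1r wu.
have a1 : y ^+ l * (a * conj a - 1) = 0.
  by rewrite mulrBr mulr1 -{2}[y ^+ l]mulr1 -uv ya -/a [a * _]mulrC subrr.
have yv : y ^+ l *: (v - conj a *: w) = 0.
  apply: (form_nondeg hs) => u'.
  by rewrite (formZr hs) (formDr hs) (formNr hs) (formZr hs) mulrBr ya subrr.
have [b [b1 yb]] := norm_one_lift rr a1; exists b; split=> //.
have {}yb : y ^+ l * b = y ^+ l * a by apply/eqP; rewrite -subr_eq0 -mulrBr yb.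
have {}yv : y ^+ l *: v = (y ^+ l * conj a) *: w.
  by apply/eqP; rewrite -subr_eq0 -scalerA -scalerBr yv.
have {}a1 : y ^+ l * (a * conj a) = y ^+ l.
  by apply/eqP; rewrite -subr_eq0 -[X in _ - X]mulr1 -mulrBr a1.
apply/eqP; rewrite scalerBr subr_eq0 scalerA yb [y ^+ l * a]mulrC -scalerA yv.
by rewrite scalerA mulrCA a1.
Qed.

End CongruenceCharacters.

(** * The centralizer and the character norm of Top *)

Section WeilTop.
Variables (A : finComNzRingType) (F : finFieldType) (conj : A -> A) (y : A).
Variables (res : {rmorphism A -> F}) (l p : nat).
Hypothesis rr : ramified_ring conj y res l p.
Variables (V : finLmodType A) (h : V -> V -> A).
Hypothesis hs : hermitian_space conj y l h.
Variable mu : A -> algC.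
Hypothesis mc : weil_character conj mu.
Variables (U : {group {perm V}}) (T : {set V}).
Hypothesis memU : forall g : {perm V}, g \in U <-> isometry_of h g.
Hypothesis transT : forall v, exists! t, t \in T /\ y ^+ l *: (v - t) = 0.
Variable rG : mx_representation algC U #|T|.

Definition cong (v w : V) : bool := y ^+ l *: (v - w) == 0.

Hypothesis rGE : forall g i j,
  rG g i j = if cong (g (enum_val i)) (enum_val j)
             then mu (h (g (enum_val i)) (enum_val j)) else 0.

Local Notation tv i := (@enum_val V (mem T) i).
Local Notation primT := (fun i : 'I_#|T| => prim_vec y l (tv i)).

Lemma cong_sym v w : cong v w = cong w v.
Proof. by rewrite /cong -opprB scalerN oppr_eq0. Qed.

Lemma cong_trans : transitive cong.
Proof.
move=> u v w /eqP vu /eqP uw; apply/eqP.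
by rewrite -[v](subrK u) -addrA scalerDr vu uw addr0.
Qed.

Lemma cong_left_trans v w u : cong v w -> cong v u = cong w u.
Proof.
move=> vw; apply/idP/idP; last exact: cong_trans.
by apply: cong_trans; rewrite cong_sym.
Qed.

Lemma cong_right_trans v w u : cong v w -> cong u v = cong u w.
Proof. by move=> vw; rewrite !(cong_sym u); apply: cong_left_trans. Qed.

Lemma isometryB (f : V -> V) v w : isometry_of h f -> f (v - w) = f v - f w.
Proof.
by case=> fl _; have := fl (-1) w v; rewrite !scaleN1r addrC => ->; rewrite addrC.
Qed.

Lemma isometryZ (f : V -> V) a v : isometry_of h f -> f (a *: v) = a *: f v.
Proof.
move=> fI; have f0 : f 0 = 0 by have := isometryB v v fI; rewrite !subrr.
by case: fI => fl _; have := fl a v 0; rewrite f0 !addr0.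
Qed.

Lemma isometry_eq0 (g : {perm V}) v : isometry_of h g -> (g v == 0) = (v == 0).
Proof.
move=> gI; have g0 : g 0 = 0 by have := isometryB v v gI; rewrite !subrr.
by rewrite -{1}g0 (inj_eq perm_inj).
Qed.

Lemma cong_isometry (g : {perm V}) v w : g \in U -> cong (g v) (g w) = cong v w.
Proof.
move=> /memU gI; rewrite /cong -isometryB // -isometryZ //.
exact: isometry_eq0.
Qed.

Lemma prim_cong (v w : V) : cong v w -> prim_vec y l v = prim_vec y l w.
Proof.
move=> /eqP vw; rewrite /prim_vec; suff -> : y ^+ (l + l).-1 *: v = y ^+ (l + l).-1 *: w
  by [].
apply/eqP; rewrite -subr_eq0 -scalerBr.
have /subnK <- : (l <= (l + l).-1)%N.
  by rewrite -ltnS prednK ?addn_gt0 ?(l_pos rr) // -addn1 leq_add2l (l_pos rr).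
by rewrite exprD -scalerA vw scaler0.
Qed.

Lemma prim_isometry (g : {perm V}) v : g \in U -> prim_vec y l (g v) = prim_vec y l v.
Proof.
move=> /memU gI; rewrite /prim_vec -isometryZ //.
by rewrite isometry_eq0.
Qed.

Lemma prim_scale a (v : V) : a * conj a = 1 -> prim_vec y l v -> prim_vec y l (a *: v).
Proof.
move=> a1 pv; apply: contraNneq pv => e.
have -> : y ^+ (l + l).-1 *: v = conj a *: (y ^+ (l + l).-1 *: (a *: v)).
  by rewrite !scalerA; congr (_ *: v); rewrite -[LHS]mulr1 -a1; ring.
by rewrite e scaler0.
Qed.

Lemma rep_exists v : exists i : 'I_#|T|, cong v (tv i).
Proof.
have [t [[tT vt] _]] := transT v; exists (enum_rank_in tT t).
by rewrite enum_rankK_in //; apply/eqP.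
Qed.

Lemma cong_inj (i j : 'I_#|T|) : cong (tv i) (tv j) -> i = j.
Proof.
move=> /eqP ij; apply: enum_val_inj; have [t [_ tu]] := transT (tv i).
rewrite -(tu (tv j)); last by split=> //; apply: enum_valP.
by apply/esym/tu; split; [exact: enum_valP | rewrite subrr scaler0].
Qed.

Lemma repr_row_single (g : {perm V}) (i j : 'I_#|T|) : cong (g (tv i)) (tv j) ->
  row i (rG g) = mu (h (g (tv i)) (tv j)) *: delta_mx 0 j.
Proof.
move=> ij; apply/rowP => k; rewrite !mxE rGE eqxx andTb.
have [->|kj] := eqVneq k j; first by rewrite ij mulr1.
rewrite mulr0; case: ifP => // ik; case/eqP: kj.
by apply: cong_inj; rewrite -(cong_left_trans _ ik).
Qed.

Lemma repr_stable (g : {perm V}) (i j : 'I_#|T|) : g \in U -> primT j -> ~~ primT i ->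
  rG g i j = 0.
Proof.
move=> gU pj pi; rewrite rGE; case: ifP => // ij.
by rewrite -(prim_cong ij) prim_isometry // (negPf pi) in pj.
Qed.

Lemma scale_in_center a : a * conj a = 1 -> exists2 z : {perm V},
  z \in U & (forall v, z v = a *: v) /\ (forall g, g \in U -> commute g z).
Proof.
move=> a1; have [z zE zI] := isometry_perm hs (isometry_scale rr hs a1).
exists z; first exact/memU.
split=> // g /memU gI; apply/permP => v.
by rewrite !permM !zE isometryZ.
Qed.

Definition norm_one_multiple (i j : 'I_#|T|) : bool :=
  [exists a, (a * conj a == 1) && cong (tv j) (a *: tv i)].

Definition congruence_elt (g : {perm V}) : bool :=
  (g \in U) && [forall t, cong (g t) t].

Lemma congruence_mul (g k : {perm V}) (i : 'I_#|T|) : congruence_elt g -> k \in U ->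
  rG (g * k)%g i i = rG g i i * rG k i i.
Proof.
move=> /andP[gU /forallP gc] kU; rewrite repr_mxM // !mxE (bigD1 i) //= big1 ?addr0 //.
move=> j ji; have := repr_row_single (gc (tv i)).
move/rowP/(_ j); rewrite !mxE eqxx (negPf ji) mulr0 => ->; by rewrite mul0r.
Qed.

Lemma separate (i j : 'I_#|T|) : primT i -> ~~ norm_one_multiple i j ->
  exists2 g, congruence_elt g & rG g i i != rG g j j.
Proof.
move=> pi nij; have [/existsP[g /andP[gc ne]]|/existsPn all_eq] :=
  boolP [exists g, congruence_elt g && (rG g i i != rG g j j)]; first by exists g.
case/existsP: nij.
have sep (g : {perm V}) : isometry_of h g -> (forall t, y ^+ l *: (g t - t) = 0) ->
    mu (h (g (tv i)) (tv i)) = mu (h (g (tv j)) (tv j)).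
  move=> gI gc; have gG : congruence_elt g.
    by apply/andP; split; [apply/memU | apply/forallP => t; apply/eqP].
  by have := all_eq g; rewrite gG negbK !rGE /cong !gc eqxx => /eqP.
have [a [a1 aij]] := congr_characters_separate rr hs mc pi sep.
by exists a; rewrite a1 eqxx /=; apply/eqP.
Qed.

(** Each nonzero entry of row i is matched by a multiple of the operator of a central norm 1 scalar,
    and [P] is their sum. [P] depends on i, so the comparison with [B] is made one row at a time. *)
Lemma centralizer_row B (i : 'I_#|T|) : centralizes rG B ->
    (forall j k, ~~ primT j || ~~ primT k -> B j k = 0) ->
  exists P, [/\ centralizes rG P, row i P = row i B &
                forall C, centralizes rG C -> P *m C = C *m P].
Proof.
move=> cB B0.
have /fin_all_exists[Z ZP] : forall j, exists Z, [/\ centralizes rG Z,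
    row i Z = B i j *: delta_mx 0 j & forall C, centralizes rG C -> Z *m C = C *m Z].
  move=> j; have [Bij|Bij] := eqVneq (B i j) 0.
    exists 0; split=> [g _||C _]; rewrite ?mulmx0 ?mul0mx //.
    by rewrite Bij scale0r; apply/rowP => k; rewrite !mxE.
  have pi : primT i by apply: contraNT Bij => /negPf pi; rewrite B0 // pi.
  (* For g in the congruence subgroup, entry (i, j) of the commutation relation says that [B i j]
     times the difference of the characters of i and j at g is 0. *)
  have : norm_one_multiple i j.
    apply: contraNT Bij => /(separate pi)[g gc].
    have /andP[gU /forallP gt] := gc.
    have := congr1 (fun M : 'M_#|T| => M i j) (cB g gU); rewrite !mxE.
    rewrite (bigD1 i) //= [X in _ + X]big1 ?addr0; last first.
      move=> k ki; have /rowP/(_ k) := repr_row_single (gt (tv i)).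
      by rewrite !mxE eqxx (negPf ki) mulr0 => ->; rewrite mul0r.
    rewrite (bigD1 j) //= [X in _ + X]big1 ?addr0; last first.
      move=> k kj; have /rowP/(_ j) := repr_row_single (gt (tv k)).
      by rewrite !mxE eqxx eq_sym (negPf kj) mulr0 => ->; rewrite mulr0.
    move/eqP; rewrite [B i j * _]mulrC -subr_eq0 -mulrBl mulf_eq0 subr_eq0.
    by case/orP => // /eqP ->; rewrite eqxx.
  case/existsP => a /andP[/eqP a1 aij].
  have [z zU [zE zC]] := scale_in_center a1.
  have zij : cong (z (tv i)) (tv j) by rewrite zE cong_sym.
  exists ((B i j / mu (h (z (tv i)) (tv j))) *: rG z); split=> [g gU||C cC].
  - rewrite -scalemxAl -scalemxAr; congr (_ *: _).
    by rewrite -!repr_mxM //; congr (rG _); apply: zC.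
  - by rewrite linearZ /= (repr_row_single zij) scalerA divfK ?(mu_neq0 mc).
  - by rewrite -scalemxAl -scalemxAr cC.
exists (\sum_j Z j); split=> [g gU||C cC].
- rewrite mulmx_sumr mulmx_suml; apply: eq_bigr => j _.
  by have [cZ _ _] := ZP j; apply: cZ.
- rewrite linear_sum /= [RHS]row_sum_delta; apply: eq_bigr => j _.
  by have [_ -> _] := ZP j; rewrite mxE.
- rewrite mulmx_sumr mulmx_suml; apply: eq_bigr => j _.
  by have [_ _ ZC] := ZP j; apply: ZC.
Qed.

(** In row i, [B] and [C] may be replaced by [P] and [Q], which commute with the whole centralizer
    and belong to it. *)
Lemma centralizer_comm B C : centralizes rG B -> centralizes rG C ->
    (forall i j, ~~ primT i || ~~ primT j -> B i j = 0) ->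
    (forall i j, ~~ primT i || ~~ primT j -> C i j = 0) ->
  B *m C = C *m B.
Proof.
move=> cB cC B0 C0; apply/row_matrixP => i; rewrite !row_mul.
have [P [cP Pi PC]] := centralizer_row i cB B0.
have [Q [cQ Qi QC]] := centralizer_row i cC C0.
by rewrite -Pi -Qi -!row_mul PC // QC // !row_mul -Pi -Qi -!row_mul QC.
Qed.

(** pA = 0, so the values of mu are p-th roots of unity. *)
Lemma mu_conj a : (mu a)^* = (mu a)^-1.
Proof.
have muX n : mu (a *+ n) = mu a ^+ n.
  by elim: n => [|n IHn]; rewrite ?(mu0 mc) // mulrS (muD mc) IHn exprS.
have p_gt0 : (0 < p)%N := prime_gt0 (pcharf_prime (pcharA rr)).
have mu1 : `|mu a| = 1.
  apply/eqP; rewrite -(pexpr_eq1 p_gt0) ?normr_ge0 // -normrX -muX -mulr_natr.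
  by rewrite (pcharf0 (pcharA rr)) mulr0 (mu0 mc) normr1.
by rewrite invC_norm mu1 expr1n invr1 mul1r.
Qed.

(** A central scalar z sends e_i to a nonzero multiple of e_j; compare the (i, j) entries of gz =
    zg. *)
Lemma diag_norm_one g i j : g \in U -> norm_one_multiple i j ->
  rG g i i = rG g j j.
Proof.
move=> gU /existsP[a /andP[/eqP a1 aij]].
have [z zU [zE zC]] := scale_in_center a1.
have zij : cong (z (tv i)) (tv j) by rewrite zE cong_sym.
have := congr1 (fun g => rG g i j) (zC g gU); rewrite !repr_mxM // !mxE.
rewrite (bigD1 i) //= [X in _ + X]big1 ?addr0 => [|k ki]; last first.
  rewrite [rG z k j]rGE; case: ifP => zkj; rewrite ?mulr0 //; case/eqP: ki.
  by apply: cong_inj; rewrite -(cong_isometry _ _ zU) (cong_left_trans _ zkj) cong_sym.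
rewrite (bigD1 j) //= [X in _ + X]big1 ?addr0 => [|k kj]; last first.
  have /rowP/(_ k) := repr_row_single zij.
  by rewrite !mxE eqxx (negPf kj) mulr0 => ->; rewrite mul0r.
rewrite [RHS]mulrC; apply: mulIf.
by rewrite rGE zij (mu_neq0 mc).
Qed.

Definition cong_stab i : {set {perm V}} := [set g in U | cong (g (tv i)) (tv i)].

Lemma sum_diag_eq i j : norm_one_multiple i j ->
  \sum_(g in U) rG g i i * (rG g j j)^* = #|cong_stab i|%:R.
Proof.
move=> nij; rewrite -[#|cong_stab i|]sum1_card natr_sum [RHS]big_mkcond /=
  [LHS]big_mkcond /=.
apply: eq_bigr => g _; rewrite inE; case: ifP => //= gU.
rewrite -(diag_norm_one gU nij) rGE; case: ifP => _; rewrite ?mul0r //.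
by rewrite mu_conj mulfV ?(mu_neq0 mc).
Qed.

(** Translating the sum by a congruence element that separates i and j multiplies it by a number
    other than 1. *)
Lemma sum_diag_neq i j : primT i -> ~~ norm_one_multiple i j ->
  \sum_(g in U) rG g i i * (rG g j j)^* = 0.
Proof.
move=> pi /(separate pi)[g gc ne]; set S := \sum_(_ in _) _.
have gU : g \in U by case/andP: gc.
have : S = rG g i i * (rG g j j)^* * S.
  rewrite {1}/S (reindex_inj (mulgI g)) /= mulr_sumr; apply: eq_big => k.
    by rewrite groupMl.
  by rewrite groupMl // => kU; rewrite !congruence_mul // rmorphM mulrACA.
move/eqP; rewrite eq_sym -subr_eq0 -[X in _ - X]mul1r -mulrBl mulf_eq0.
case/orP => /eqP // e; case/eqP: ne.
have /andP[_ /forallP gt] := gc.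
have jj : rG g j j != 0 by rewrite rGE gt (mu_neq0 mc).
have cj : (rG g j j)^* = (rG g j j)^-1 by rewrite !rGE gt mu_conj.
by apply: (mulIf (invr_neq0 jj)); rewrite mulfV // -cj; apply/eqP; rewrite -subr_eq0 e.
Qed.

Variable W : 'M[algC]_#|T|.
Hypothesis defW : W = (\sum_(i < #|T| | primT i) <<delta_mx 0 i : 'rV_#|T|>>)%MS.
Hypothesis Wmod : mxmodule rG W.

Lemma norm_top : '[cfRepr (submod_repr Wmod)] * #|U|%:R =
  (\sum_(i | primT i) #|cong_stab i| * #|[set j | norm_one_multiple i j]|)%:R.
Proof.
rewrite cfdotE mulrC mulrA mulfV ?neq0CG // mul1r.
transitivity (\sum_(g in U) \sum_(i | primT i) \sum_(j | primT j) rG g i i * (rG g j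
  j)^*).
  apply: eq_bigr => g gU; rewrite !cfunE gU mulr1n (coord_submod_trace defW) //.
  by rewrite rmorph_sum mulr_suml; apply: eq_bigr => i _; rewrite mulr_sumr.
rewrite exchange_big natr_sum /=; apply: eq_bigr => i pi.
rewrite exchange_big natrM -[#|[set j | _ i j]|]sum1_card natr_sum mulr_sumr /=
  big_mkcond [RHS]big_mkcond /=.
apply: eq_bigr => j _; rewrite inE.
have [nij|nij] := boolP (norm_one_multiple i j); last first.
  by case: ifP => // _; rewrite sum_diag_neq.
have -> : primT j.
  case/existsP: nij => a /andP[/eqP a1 aij].
  by rewrite (prim_cong aij) prim_scale.
by rewrite (sum_diag_eq nij) mulr1.
Qed.

Definition norm_one_values : {set A} :=
  [set y ^+ l * a | a in [set a | a * conj a == 1]].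

(** Pairing with a dual vector of [tv i] reads off the class modulo i of the scalar from its
    multiple. *)
Lemma card_norm_one_multiple i : primT i ->
  #|[set j | norm_one_multiple i j]| = #|norm_one_values|.
Proof.
move=> pi; have [u uv] := prim_dual rr hs pi.
have valj a j : cong (tv j) (a *: tv i) -> y ^+ l * h u (tv j) = y ^+ l * a.
  move=> /eqP aij; apply/eqP; rewrite -subr_eq0 -mulrBr -[a in X in _ * X]mulr1 -uv.
  by rewrite -(formZr hs) -(formNr hs) -(formDr hs) -(formZr hs) aij (form0r hs).
rewrite -(@card_in_imset _ _ (fun j => y ^+ l * h u (tv j))).
  apply: eq_card => t; apply/imsetP/imsetP => [[j]|[a]].
    rewrite inE => /existsP[a /andP[a1 aij]] ->; exists a; first by rewrite inE.
    exact: valj.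
  rewrite inE => a1 ->; have [j aij] := rep_exists (a *: tv i).
  rewrite cong_sym in aij; exists j; last by rewrite (valj a).
  by rewrite inE; apply/existsP; exists a; rewrite a1.
move=> j k; rewrite !inE => /existsP[a /andP[_ aij]] /existsP[b /andP[_ bik]].
rewrite (valj a) // (valj b) // => ab; apply: cong_inj.
rewrite (cong_left_trans _ aij) cong_sym (cong_left_trans _ bik).
by rewrite /cong scalerBr !scalerA ab subrr.
Qed.

Definition self_value v : A := y ^+ l * h v v.

Definition self_values : {set A} :=
  [set self_value v | v in [set v | prim_vec y l v]].

(** Orbit-stabilizer on classes modulo i: Witt's theorem identifies the orbit with the vectors of
    equal [self_value], and the fibres of [f] are cosets of the stabilizer. *)
Lemma card_cong_orbit i : primT i ->
  (#|cong_stab i| * #|[set j | primT j & self_value (tv j) == self_value (tv i)]|)%N =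
    #|U|.
Proof.
move=> pi; rewrite -[RHS]sum1_card.
pose f (g : {perm V}) := xchoose (rep_exists (g (tv i))).
have fP (g : {perm V}) : cong (g (tv i)) (tv (f g)) by apply: (xchooseP (rep_exists _)).
rewrite (partition_big f (mem [set j | primT j & self_value (tv j) == self_value (tv
  i)])) /=.
  rewrite mulnC -sum_nat_const; apply: eq_bigr => j; rewrite inE => /andP[pj /eqP ij].
  have [g0 g0I g0ij] := isometry_transitive_congr rr hs pi pj (esym ij).
  have g0U : g0 \in U by apply/memU.
  rewrite sum1_card -(card_rcoset _ g0); apply: eq_card => g.
  rewrite mem_rcoset !inE groupMr ?groupV //; apply: andb_id2l => gU.
  rewrite -(cong_isometry _ _ g0U) permM permKV (cong_right_trans _ (_ : cong (g0 (tv
    i)) (tv j))) ?/cong ?g0ij //.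
  apply/idP/eqP => [gij|<-]; last exact: fP.
  by apply: cong_inj; rewrite -(cong_left_trans _ (fP g)).
move=> g gU; rewrite inE -(prim_cong (fP g)) prim_isometry // pi /=.
have /memU[_ gh] := gU; apply/eqP; rewrite /self_value -(gh (tv i)).
by apply/esym/(congr_form_self rr hs)/eqP/fP.
Qed.

(** Vectors of equal [self_value] have stabilizers of equal order, so each orbit contributes the
    order of U. *)
Lemma sum_cong_stab : (\sum_(i | primT i) #|cong_stab i| =
  #|U| * #|self_values|)%N.
Proof.
have -> : self_values =
    [set self_value (tv i) | i in [set i | primT i]].
  apply/setP => t; apply/imsetP/imsetP => -[v]; rewrite inE => pv ->.
    have [i vi] := rep_exists v; exists i; first by rewrite inE -(prim_cong vi).
    by apply: (congr_form_self rr hs); apply/eqP.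
  by exists (tv v); rewrite ?inE.
rewrite (eq_bigl (fun i => i \in [set i | primT i])); last by move=> i; rewrite inE.
rewrite (partition_big_imset (fun i => self_value (tv i))) /= mulnC -sum_nat_const.
apply: eq_bigr => t /imsetP[i]; rewrite inE => pi ->.
rewrite -(card_cong_orbit pi) mulnC -sum_nat_const.
apply: eq_big => [j|j /andP[]]; first by rewrite !inE.
rewrite inE => pj /eqP ji; have := card_cong_orbit pj; rewrite -(card_cong_orbit pi) ji.
move/eqP; rewrite eqn_pmul2r => [/eqP //|]; apply/card_gt0P; exists i.
by rewrite inE pi eqxx.
Qed.

Theorem card_irr_constt_top : #|irr_constt (cfRepr (submod_repr Wmod))| =
  (#|norm_one_values| * #|self_values|)%N.
Proof.
apply/eqP; rewrite -(eqr_nat algC) -card_irr_constt_norm; last first.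
  apply: (coord_submod_comm defW) => [g i j|B C]; first exact: repr_stable.
  exact: centralizer_comm.
apply/eqP; apply: (mulIf (_ : #|U|%:R != 0)); first exact: neq0CG.
rewrite norm_top (eq_bigr _ (fun i pi => congr1 _ (card_norm_one_multiple pi))).
rewrite -big_distrl /= sum_cong_stab -[RHS]natrM; congr (_%:R).
by rewrite -mulnA mulnC [in LHS](mulnC #|self_values|).
Qed.

End WeilTop.

(** * Counting units, norms and fixed elements modulo i *)

Section Counting.
Variables (A : finComNzRingType) (F : finFieldType) (conj : A -> A) (y : A).
Variables (res : {rmorphism A -> F}) (l p : nat).
Hypothesis rr : ramified_ring conj y res l p.
Implicit Types (a b s t : A) (B : {set A}).

Local Notation q := #|F|.

(* y^k B, a copy of the image of B modulo y^(2l-k). *)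
Definition level B k : {set A} := [set y ^+ k * b | b in B].

(** A chosen preimage under multiplication by y^k, so that the norm, squaring and the residue map
    can be evaluated on y^k a in place of a class of a. *)
Definition yquo k t : A := odflt 0 [pick a | t == y ^+ k * a].

Lemma yquoK k a : y ^+ k * yquo k (y ^+ k * a) = y ^+ k * a.
Proof. by rewrite /yquo; case: pickP => [b /eqP //|/(_ a)]; rewrite eqxx. Qed.

Lemma res_congr k a b : (k < l + l)%N -> y ^+ k * a = y ^+ k * b -> res a = res b.
Proof.
move=> kl /eqP; rewrite -subr_eq0 -mulrBr => yab.
by apply/eqP; rewrite -subr_eq0 -rmorphB; apply: contraTT yab; apply: (yX_unit rr).
Qed.

Lemma res_yquo k a : (k < l + l)%N -> res (yquo k (y ^+ k * a)) = res a.
Proof. by move=> kl; apply: (res_congr kl); apply: yquoK. Qed.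

Lemma card_level_res B k c : (k < l + l)%N ->
    (forall a b, a \in B -> b \in B -> a - b \in B) -> (exists2 b, b \in B & res b = c) ->
  #|level [set b in B | res b == c] k| = #|level [set b in B | res b == 0%R] k|.
Proof.
move=> kl BB [b0 b0B rb0].
have B0 : 0 \in B by rewrite -(subrr b0) BB.
have BD a b : a \in B -> b \in B -> a + b \in B.
  by move=> aB bB; rewrite -[b]opprK -[- b]sub0r !BB.
rewrite -[RHS](card_imset _ (addrI (y ^+ k * b0))); apply: eq_card => t.
apply/imsetP/imsetP => -[b].
  rewrite inE => /andP[bB /eqP rb] ->; exists (y ^+ k * (b - b0)).
    by apply: imset_f; rewrite inE BB //= rmorphB rb rb0 subrr.
  by rewrite -mulrDr addrC subrK.
case/imsetP => a; rewrite inE => /andP[aB /eqP ra] -> ->.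
by exists (b0 + a); rewrite ?mulrDr // inE BD //= rmorphD ra rb0 addr0.
Qed.

(** The fibres of the residue map on y^k B are translates of one another. Only subtraction and
    surjectivity onto F are required of B, so that A and its fixed ring are treated alike. *)
Lemma card_level B k (C : {set F}) : (k < l + l)%N ->
    (forall a b, a \in B -> b \in B -> a - b \in B) ->
    (forall c, exists2 b, b \in B & res b = c) ->
  #|level [set b in B | res b \in C] k| =
    (#|C| * #|level [set b in B | res b == 0%R] k|)%N.
Proof.
move=> kl BB Bres.
rewrite (@card_const_fibres _ _ (fun t => res (yquo k t))
  (level [set b in B | res b \in C] k)
  #|level [set b in B | res b == 0%R] k|).
  rewrite mulnC; congr (_ * _)%N; apply: eq_card => c; apply/imsetP/idP.
    by case=> t /imsetP[b]; rewrite inE => /andP[_ rb] -> ->; rewrite res_yquo.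
  move=> cC; have [b bB rb] := Bres c; exists (y ^+ k * b); last by rewrite res_yquo.
  by apply: imset_f; rewrite inE bB rb.
move=> t0 /imsetP[b]; rewrite inE => /andP[bB rb] ->.
rewrite -(card_level_res kl BB (Bres (res b))); apply: eq_card => t.
rewrite inE res_yquo //; apply/andP/imsetP => [[/imsetP[a]]|[a]].
  by rewrite inE => /andP[aB _] -> ra; rewrite res_yquo // in ra; exists a;
    rewrite // inE aB.
rewrite inE => /andP[aB /eqP ra] ->; rewrite res_yquo // ra; split=> //.
by apply: imset_f; rewrite inE aB ra.
Qed.

Lemma card_level_all B k : (k < l + l)%N ->
    (forall a b, a \in B -> b \in B -> a - b \in B) ->
    (forall c, exists2 b, b \in B & res b = c) ->
  #|level B k| = (q * #|level [set b in B | res b == 0%R] k|)%N.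
Proof.
move=> kl BB Bres; rewrite -cardsT -(card_level setT kl BB Bres).
by rewrite (_ : [set b in B | _] = B) //; apply/setP => b; rewrite !inE andbT.
Qed.

Lemma card_level_units B k : (k < l + l)%N ->
    (forall a b, a \in B -> b \in B -> a - b \in B) ->
    (forall c, exists2 b, b \in B & res b = c) ->
  #|level [set b in B | res b != 0] k| =
    (q.-1 * #|level [set b in B | res b == 0%R] k|)%N.
Proof.
move=> kl BB Bres; rewrite -(cardsC1 (0 : F)) -(card_level [set~ 0] kl BB Bres).
rewrite (_ : [set b in B | res b \in _] = [set b in B | res b != 0]) //.
by apply/setP => b; rewrite !inE.
Qed.

Let subT a b : a \in [set: A] -> b \in [set: A] -> a - b \in [set: A].
Proof. by rewrite !inE. Qed.

Let resT c : exists2 b, b \in [set: A] & res b = c.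
Proof. by have [b rb] := res_surj rr c; exists b. Qed.

Lemma level_res0 k : level [set b in setT | res b == 0] k = level setT k.+1.
Proof.
apply/setP => t; apply/imsetP/imsetP => -[b].
  rewrite !inE => /= /eqP/(res_eq0P rr)[c ->] ->.
  by exists c => //; rewrite mulrA -exprSr.
by move=> _ ->; exists (y * b); [rewrite !inE (res_y rr) eqxx | rewrite mulrA -exprSr].
Qed.

Lemma card_levelT k : (k <= l + l)%N -> #|level setT (l + l - k)| = (q ^ k)%N.
Proof.
elim: k => [_|k IHk kl].
  rewrite subn0 expn0 -(cards1 (0 : A)); apply: eq_card => t.
  apply/imsetP/set1P => [[b _ ->]|->]; first by rewrite (y_nilp rr) mul0r.
  by exists 0; rewrite ?mulr0.
rewrite card_level_all //; first by rewrite level_res0 subnSK // IHk ?expnS // ltnW.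
by rewrite ltn_subrL (leq_trans _ kl).
Qed.

Lemma card_unit_level : #|level [set a | res a != 0] l| = (q ^ l - q ^ l.-1)%N.
Proof.
have ll : (l < l + l)%N by rewrite -addn1 leq_add2l (l_pos rr).
have -> : [set a | res a != 0] = [set a in setT | res a != 0] by apply/setP=> a;
  rewrite !inE.
rewrite card_level_units // level_res0 -subn1 mulnBl mul1n.
have -> : l.+1 = (l + l - l.-1)%N.
  by rewrite (_ : l + l = l.+1 + l.-1)%N ?addnK // addSnnS prednK ?(l_pos rr).
rewrite card_levelT; last by rewrite (leq_trans (leq_pred l)) ?leq_addr.
by rewrite -expnS prednK ?(l_pos rr).
Qed.

Lemma norm_congr a b : y ^+ l * a = y ^+ l * b ->
  y ^+ l * (a * conj a) = y ^+ l * (b * conj b).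
Proof.
move=> ab; have ab' : y ^+ l * conj a = y ^+ l * conj b.
  have := congr1 (fun t => (-1) ^+ l * conj t) ab; rewrite /= !(conjM rr) !(conj_yX rr).
  by rewrite !mulrA -!exprD -signr_odd addnn odd_double !mul1r.
by rewrite mulrA ab mulrAC ab' mulrAC mulrA.
Qed.

Definition norm_values : {set A} := level [set a * conj a | a in [set a | res a != 0]] l.

(** The fibres of the norm on (A/i)^* are cosets of the elements of norm 1 modulo i, and by
    [norm_one_lift] these come from scalars of norm exactly 1. *)
Lemma card_norm_values :
  (#|norm_one_values conj y l| * #|norm_values|)%N = (q ^ l - q ^ l.-1)%N.
Proof.
rewrite -card_unit_level.
rewrite (@card_const_fibres _ _ (fun t => y ^+ l * (yquo l t * conj (yquo l t)))
  (level [set a | res a != 0] l)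
  #|norm_one_values conj y l|).
  congr (_ * _)%N; apply: eq_card => t; apply/imsetP/imsetP.
    case=> _ /imsetP[a ra ->] ->; exists (y ^+ l * a); first exact: imset_f.
    by apply: norm_congr; rewrite yquoK.
  case=> _ /imsetP[a ra ->] ->; exists (a * conj a); first exact: imset_f.
  by apply: norm_congr; rewrite yquoK.
move=> t0 /imsetP[a]; rewrite inE => ra ->; have [i ai] := res_inv rr ra.
have ia : injective ( *%R^~ a) by apply: (can_inj (g := *%R^~ i)) => b;
  rewrite -mulrA ai mulr1.
rewrite -[RHS](card_imset _ ia); apply: eq_card => t;
  rewrite inE (norm_congr (yquoK l a)).
apply/andP/imsetP => [[/imsetP[b]]|[t1 /imsetP[c]]].
  rewrite inE => rb ->; rewrite (norm_congr (yquoK l b)) => /eqP nab.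
  have [|c [c1 cb]] := @norm_one_lift _ _ _ _ _ _ _ rr (b * i).
    transitivity (y ^+ l * (b * conj b) * (i * conj i) - y ^+ l).
      by rewrite (conjM rr); ring.
    rewrite nab (_ : _ * (a * conj a) * _ = y ^+ l * ((a * i) * conj (a * i))).
      by rewrite ai (conj1 rr) !mulr1 subrr.
    by rewrite (conjM rr); ring.
  exists (y ^+ l * c); first by apply: imset_f; rewrite inE c1.
  apply/eqP; rewrite eq_sym -subr_eq0; apply/eqP; rewrite -[RHS](mul0r a) -cb.
  rewrite [LHS](_ : _ = y ^+ l * (c * a - b * (a * i))); first by ring.
  by rewrite ai; ring.
rewrite inE => /eqP c1 -> ->; rewrite -mulrA (norm_congr (yquoK l _)); split.
  apply: imset_f; rewrite inE rmorphM mulf_neq0 //.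
  exact: (res_inv_neq0 res c1).
by rewrite (conjM rr) mulrACA c1 mul1r.
Qed.

Definition fixed_ring : {set A} := [set s | conj s == s].

Lemma fixed_lift c : exists2 s, s \in fixed_ring & res s = c.
Proof.
(* Average a lift with its conjugate; conjugation does not move the residue. *)
have [a ra] := res_surj rr c; exists ((p.+1./2)%:R * (a + conj a)).
  by rewrite inE (conjM rr) (conjMn rr) (conj1 rr) (conjD rr) (conjK rr) [conj a +
    a]addrC.
rewrite rmorphM rmorphD (res_conj rr) ra -mulr2n -[c *+ 2]mulr_natl mulrA.
have := congr1 res (half_two rr); rewrite rmorphM (rmorph_nat res 2) rmorph1 => ->.
by rewrite mul1r.
Qed.

(** a a^* has residue res(a)^2. Dividing it by e^2, for a fixed lift e of res(a), leaves a fixed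
    element of residue 1, which has a fixed square root. *)
Lemma norm_is_square a : res a != 0 ->
  exists s, [/\ conj s = s, res s != 0 & s ^+ 2 = a * conj a].
Proof.
move=> ra; have [e ee re] := fixed_lift (res a); rewrite inE in ee; move/eqP: ee => ce.
have [i ei] : exists i, e * i = 1 by apply: (res_inv rr); rewrite re.
have ci := conj_inv rr ce ei.
have ri : res e * res i = 1 by rewrite -rmorphM ei rmorph1.
have [||s [cs rs s2]] := @exists_sqrt _ _ _ _ _ _ _ rr (a * conj a * i ^+ 2).
- by rewrite (conjM rr) (conj_norm rr) (conjX rr) ci.
- rewrite !rmorphM (res_conj rr) -re.
  by transitivity ((res e * res i) ^+ 2); [ring | rewrite ri expr1n].
exists (e * s); split; first by rewrite (conjM rr) ce cs.
  by rewrite rmorphM rs mulr1 re.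
by rewrite exprMn s2 mulrCA -exprMn ei expr1n mulr1.
Qed.

Lemma norm_valuesE :
  norm_values = level [set s ^+ 2 | s in [set s in fixed_ring | res s != 0]] l.
Proof.
congr (level _ _); apply/setP => t; apply/imsetP/imsetP => -[a]; rewrite !inE.
  move=> /norm_is_square[s [cs rs s2]] ->; exists s => //.
  by rewrite !inE cs eqxx.
by case/andP=> /eqP ca ra ->; exists a; rewrite ?inE // ca.
Qed.

(** Squaring is 2-to-1 on fixed units modulo i: if (u - s)(u + s) is in i, one factor is a unit
    because their sum is 2u, so the other is in i. *)
Lemma card_fixed_units :
  #|level [set s in fixed_ring | res s != 0] l| = (2 * #|norm_values|)%N.
Proof.
have ll : (l < l + l)%N by rewrite -addn1 leq_add2l (l_pos rr).
have sqc a b : y ^+ l * a = y ^+ l * b -> y ^+ l * a ^+ 2 = y ^+ l * b ^+ 2.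
  by move=> ab; rewrite !expr2 mulrA ab mulrAC ab mulrAC mulrA.
rewrite norm_valuesE (@card_const_fibres _ _ (fun t => y ^+ l * yquo l t ^+ 2)
  (level [set s in fixed_ring | res s != 0] l) 2).
  congr (_ * _)%N; apply: eq_card => t; apply/imsetP/imsetP.
    case=> _ /imsetP[a ra ->] ->; exists (a ^+ 2); first exact: imset_f.
    by apply: sqc; rewrite yquoK.
  case=> _ /imsetP[a ra ->] ->; exists (y ^+ l * a); first exact: imset_f.
  by apply: sqc; rewrite yquoK.
move=> t0 /imsetP[s]; rewrite !inE => /andP[/eqP cs rs] ->.
have y2s : y ^+ l * s != y ^+ l * - s.
  rewrite -subr_eq0 -mulrBr; apply: (yX_unit rr ll).
  by rewrite opprK rmorphD -mulr2n -mulr_natr mulf_neq0 // (res_two rr).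
transitivity #|[set y ^+ l * s; y ^+ l * - s]|; last by rewrite cards2 y2s.
apply: eq_card => t; rewrite !inE (sqc _ _ (yquoK l s)).
apply/andP/orP => [[/imsetP[u]]|].
  rewrite !inE => /andP[/eqP cu ru] ->; rewrite (sqc _ _ (yquoK l u)) => /eqP us.
  have us0 : y ^+ l * ((u - s) * (u + s)) = 0.
    by rewrite -subr_sqr mulrBr us subrr.
  have [r0|r1] := eqVneq (res (u + s)) 0.
    right; have [i ui] : exists i, (u - s) * i = 1.
      apply: (res_inv rr); rewrite rmorphB; apply: contraNneq ru => e.
      apply/eqP; apply: (mulIf (res_two rr)); rewrite mul0r.
      transitivity (res (u + s) + (res u - res s)); first by rewrite rmorphD; ring.
      by rewrite r0 e addr0.
    rewrite -subr_eq0 -mulrBr opprK -[u + s]mul1r -ui.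
    by rewrite mulrAC mulrA us0 mul0r.
  left; have [i ui] := res_inv rr r1.
  rewrite -subr_eq0 -mulrBr -[u - s]mulr1 -ui.
  by rewrite !mulrA -(mulrA (y ^+ l)) us0 mul0r.
case=> /eqP ->; rewrite (sqc _ _ (yquoK l _)) ?sqrrN; split=> //; apply: imset_f.
  by rewrite !inE cs eqxx.
by rewrite !inE (conjN rr) cs eqxx rmorphN oppr_eq0.
Qed.

Let fixedB a b : a \in fixed_ring -> b \in fixed_ring -> a - b \in fixed_ring.
Proof. by rewrite !inE (conjB rr) => /eqP-> /eqP->. Qed.

Lemma count_fixed_units :
  (#|norm_one_values conj y l| * #|level [set s in fixed_ring | res s != 0%R] l|)%N =
  (2 * (q ^ l - q ^ l.-1))%N.
Proof. by rewrite card_fixed_units -card_norm_values mulnCA. Qed.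

(** Units make up the proportion (q - 1)/q of the fixed ring modulo i; the factor q - 1 is
    cancelled. *)
Lemma count_fixed :
  (#|norm_one_values conj y l| * #|level fixed_ring l|)%N = (2 * q ^ l)%N.
Proof.
have ll : (l < l + l)%N by rewrite -addn1 leq_add2l (l_pos rr).
have q_gt1 : (1 < q)%N by apply: finNzRing_gt1.
have ql : (q ^ l = q * q ^ l.-1)%N by rewrite -expnS prednK ?(l_pos rr).
have := count_fixed_units; rewrite (card_level_units ll fixedB fixed_lift).
rewrite (card_level_all ll fixedB fixed_lift) ql.
set n := #|level _ l|; set m := #|norm_one_values _ _ _|; set k := (_ ^ _)%N => e.
have {}e : (q.-1 * (m * n) = q.-1 * (2 * k))%N.
  by rewrite mulnCA e [RHS]mulnCA -subn1 mulnBl mul1n.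
have /eqP : (m * n == 2 * k)%N by rewrite -(eqn_pmul2l (_ : 0 < q.-1)%N) ?e // -ltnS
  prednK // ltnW.
by rewrite mulnCA => ->; rewrite mulnCA.
Qed.

End Counting.

(** * Torsion and primitive vectors in coordinates *)

Definition lm_basis (A : finComNzRingType) (V : finLmodType A) n (b : 'I_n -> V) :=
  forall v, exists! c : {ffun 'I_n -> A}, v = \sum_i c i *: b i.

Section Bases.
Variables (A : finComNzRingType) (F : finFieldType) (conj : A -> A) (y : A).
Variables (res : {rmorphism A -> F}) (l p : nat).
Hypothesis rr : ramified_ring conj y res l p.
Variables (V : finLmodType A) (n : nat) (b : 'I_n -> V).
Hypothesis bb : lm_basis b.
Implicit Types c : {ffun 'I_n -> A}.

Lemma basis_eq0 c : \sum_i c i *: b i = 0 -> forall i, c i = 0.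
Proof.
move=> c0 i; have [d [_ du]] := bb 0.
have dc : d = c by apply: du; rewrite c0.
have d0 : d = [ffun=> 0].
  by apply: du; rewrite big1 // => j _; rewrite ffunE scale0r.
by rewrite -dc d0 ffunE.
Qed.

Lemma basis_torsion k v : (k <= l + l)%N -> y ^+ k *: v = 0 ->
  exists w : V, v = y ^+ (l + l - k) *: w.
Proof.
move=> kl yv; have [c [Dv _]] := bb v.
have c0 i : y ^+ k * c i = 0.
  have := @basis_eq0 [ffun i => y ^+ k * c i]; rewrite /= => /(_ _ i).
  rewrite ffunE; apply; rewrite -[RHS]yv Dv scaler_sumr.
  by apply: eq_bigr => j _; rewrite ffunE scalerA.
have /fin_all_exists[d Dd] : forall i, exists d, c i = y ^+ (l + l - k) * d.
  by move=> i; apply/(yX_eq0 rr).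
exists (\sum_i d i *: b i); rewrite {1}Dv scaler_sumr.
by apply: eq_bigr => i _; rewrite scalerA -Dd.
Qed.

Lemma basis_prim c i : res (c i) != 0 -> prim_vec y l (\sum_i c i *: b i).
Proof.
move=> ri; apply/eqP; rewrite scaler_sumr => c0.
have ll : ((l + l).-1 < l + l)%N by rewrite prednK // addn_gt0 (l_pos rr).
have := yX_unit rr ll ri.
have := @basis_eq0 [ffun i => y ^+ (l + l).-1 * c i]; rewrite /= => /(_ _ i).
rewrite ffunE => ->; rewrite ?eqxx // -[RHS]c0.
by apply: eq_bigr => j _; rewrite ffunE scalerA.
Qed.

Lemma basis_single (i : 'I_n) a : \sum_j [ffun j => if j == i then a else 0] j *: b j =
  a *: b i.
Proof.
rewrite (bigD1 i) //= big1 => [|j /negPf ji]; rewrite ffunE ?eqxx ?addr0 //.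
by rewrite ji scale0r.
Qed.

Lemma basis_prim3 (i j k : 'I_n) a1 a2 : i != k -> j != k ->
  prim_vec y l (a1 *: b i + a2 *: b j + b k).
Proof.
move=> ik jk; pose c m a : {ffun 'I_n -> A} := [ffun j => if j == m then a else 0].
have -> : a1 *: b i + a2 *: b j + b k = \sum_m (c i a1 + c j a2 + c k 1) m *: b m.
  rewrite -[b k]scale1r -!basis_single -!big_split /=; apply: eq_bigr => m _.
  by rewrite !ffunE !scalerDl.
apply: (@basis_prim _ k).
by rewrite !ffunE eqxx ![k == _]eq_sym (negPf ik) (negPf jk) !add0r rmorph1 oner_neq0.
Qed.

End Bases.

(** * The values h(v, v) modulo i on primitive vectors *)

Section SelfValues.
Variables (A : finComNzRingType) (F : finFieldType) (conj : A -> A) (y : A).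
Variables (res : {rmorphism A -> F}) (l p : nat).
Hypothesis rr : ramified_ring conj y res l p.
Variables (V : finLmodType A) (h : V -> V -> A).
Hypothesis hs : hermitian_space conj y l h.
Implicit Types (a s : A) (u v w : V).

Lemma not_prim_y (w : V) : ~~ prim_vec y l (y *: w).
Proof.
rewrite negbK scalerA -exprSr prednK ?addn_gt0 ?(l_pos rr) //.
by rewrite (y_nilp rr) scale0r.
Qed.

Lemma self_values_sub : self_values y l h \subset level y (fixed_ring conj) l.
Proof.
apply/subsetP => _ /imsetP[v _ ->]; apply: imset_f.
by rewrite inE (form_self hs).
Qed.

(** Lengths are norms times the unit h(b, b), and multiplication by a unit is injective. *)
Lemma self_values_rank1 (b : 'I_1 -> V) : lm_basis b ->
  #|self_values y l h| = #|norm_values conj y res l|.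
Proof.
move=> bb; have span v : exists a, v = a *: b ord0.
  by have [c [Dv _]] := bb v; exists (c ord0); rewrite {1}Dv big_ord1.
have pb : prim_vec y l (b ord0).
  have := @basis_prim _ _ _ _ _ _ _ rr _ _ _ bb [ffun=> 1] ord0.
  by rewrite big_ord1 !ffunE scale1r rmorph1 oner_neq0 => /(_ isT).
have rho_unit : res (h (b ord0) (b ord0)) != 0.
  have [u] := prim_dual rr hs pb; have [a ->] := span u.
  by rewrite (formZl rr hs) mulrC => /res_inv_neq0.
have [i rhoi] := res_inv rr rho_unit; set rho := h _ _ in rhoi.
have inj_rho : injective ( *%R^~ rho).
  by apply: (can_inj (g := *%R^~ i)) => t; rewrite -mulrA rhoi mulr1.
have val a : h (a *: b ord0) (a *: b ord0) = a * conj a * rho.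
  by rewrite (formZl rr hs) (formZr hs) /rho; ring.
rewrite -[RHS](card_imset _ inj_rho); apply: eq_card => t.
apply/imsetP/imsetP => [[v]|[t1 /imsetP[t2 /imsetP[a]]]].
  have [a ->] := span v; rewrite inE => pv ->.
  exists (y ^+ l * (a * conj a)); last by rewrite /self_value val mulrA.
  apply/imset_f/imset_f; rewrite inE; apply: contraTneq pv => /(res_eq0P rr)[c ->].
  by rewrite -scalerA; apply: not_prim_y.
rewrite inE => ra -> -> ->; exists (a *: b ord0); last by rewrite /self_value val mulrA.
rewrite inE; apply: (prim_of_dual rr hs (u := b ord0)).
by rewrite (formZr hs) rmorphM mulf_neq0.
Qed.

Lemma form2 (b1 b2 : V) r1 r2 a1 a2 : h b1 b1 = r1 -> h b2 b2 = r2 -> h b1 b2 = 0 ->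
  h (a1 *: b1 + a2 *: b2) (a1 *: b1 + a2 *: b2) =
    a1 * conj a1 * r1 + a2 * conj a2 * r2.
Proof.
move=> h1 h2 h12; have h21 : h b2 b1 = 0 by rewrite (formC hs) h12 (conj0 rr).
rewrite !(formDr hs) !(formDl hs) !(formZl rr hs) !(formZr hs) h1 h2 h12 h21.
by ring.
Qed.

(** Over F the form s^2 - e t^2 has no nontrivial zero, so primitive vectors have unit length.
    Conversely it takes every value over F, and a vector whose length tau has the residue of the
    target s is rescaled by the square root of s/tau. *)
Lemma self_values_anisotropic (b : 'I_2 -> V) e : lm_basis b ->
    h (b ord0) (b ord0) = 1 -> h (b ord_max) (b ord_max) = - e ->
    h (b ord0) (b ord_max) = 0 -> res e != 0 -> (forall s : F, s ^+ 2 != res e) ->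
  self_values y l h = level y [set s in fixed_ring conj | res s != 0] l.
Proof.
move=> bb h1 h2 h12 re nsq.
have ce : conj e = e by rewrite -[e]opprK -h2 (conjN rr) (form_self hs).
apply/setP => t; apply/imsetP/imsetP => [[v]|[s]].
  rewrite inE => pv ->; exists (h v v) => //.
  rewrite !inE (form_self hs) eqxx /=; apply: contraTneq pv.
  have [c [-> _]] := bb v; rewrite big_ord_recl big_ord1.
  rewrite (_ : lift ord0 ord0 = ord_max); last exact/val_inj.
  move: (c ord0) (c ord_max) => c0 c1.
  rewrite (form2 _ _ h1 h2 h12) rmorphD !rmorphM !(res_conj rr) rmorphN rmorph1 mulr1.
  rewrite mulrN => /eqP; rewrite subr_eq0 => /eqP e0.
  have r1 : res c1 = 0.
    apply/eqP; apply: contraNT (nsq (res c0 / res c1)) => r1; apply/eqP.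
    by rewrite exprMn exprVn expr2 e0 mulrAC -expr2 mulfV ?mul1r // expf_neq0.
  have r0 : res c0 = 0.
    by apply/eqP; move: e0; rewrite r1 mulr0 mul0r => /eqP; rewrite mulf_eq0 orbb.
  have [d0 ->] := (res_eq0P rr _).1 r0; have [d1 ->] := (res_eq0P rr _).1 r1.
  by rewrite -!scalerA -scalerDr; apply: not_prim_y.
rewrite !inE => /andP[/eqP cs rs] ->.
have re' : - res e != 0 by rewrite oppr_eq0.
have [a0 [c0 ac]] := binary_form_universal (res_two rr) (res s) (oner_neq0 F) re'.
have [a] := fixed_lift rr a0; rewrite inE => /eqP ca ra.
have [c] := fixed_lift rr c0; rewrite inE => /eqP cc rc.
pose tau := a ^+ 2 - e * c ^+ 2.
have rtau : res tau = res s.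
  by rewrite -ac rmorphB !rmorphM ra rc; ring.
have ctau : conj tau = tau by rewrite (conjB rr) (conjM rr e) !(conjX rr) ca cc ce.
have [i ti] : exists i, tau * i = 1 by apply: (res_inv rr); rewrite rtau.
have [||rho [crho _ rho2]] := exists_sqrt rr (r := s * i).
- by rewrite (conjM rr) cs (conj_inv rr ctau ti).
- by rewrite rmorphM -rtau -rmorphM ti rmorph1.
pose v := (rho * a) *: b ord0 + (rho * c) *: b ord_max.
have hv : h v v = s.
  rewrite (form2 _ _ h1 h2 h12) !(conjM rr) crho ca cc.
  transitivity (rho ^+ 2 * tau); first by rewrite /tau; ring.
  by rewrite rho2 -mulrA [i * _]mulrC ti mulr1.
exists v; last by rewrite /self_value hv.
by rewrite inE; apply: (prim_of_dual rr hs (u := v)); rewrite hv.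
Qed.

Lemma self_values_hyperbolic (b : 'I_2 -> V) :
    h (b ord0) (b ord0) = 1 -> h (b ord_max) (b ord_max) = - 1 ->
    h (b ord0) (b ord_max) = 0 ->
  self_values y l h = level y (fixed_ring conj) l.
Proof.
move=> h1 h2 h12; apply/eqP; rewrite eqEsubset self_values_sub /=.
apply/subsetP => t0 /imsetP[s]; rewrite inE => /eqP cs ->.
set H : A := (p.+1./2)%:R; have cH : conj H = H by rewrite (conjMn rr) (conj1 rr).
have H2 : H * 2 = 1 := half_two rr.
have h21 : h (b ord_max) (b ord0) = 0 by rewrite (formC hs) h12 (conj0 rr).
(* From ((s + 1)/2)^2 - ((s - 1)/2)^2 = s. *)
pose v := (H * (s + 1)) *: b ord0 + (H * (s - 1)) *: b ord_max.
have hv : h v v = s.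
  rewrite (form2 _ _ h1 h2 h12) !(conjM rr) cH (conjD rr) (conjB rr) cs (conj1 rr).
  by transitivity ((H * 2) ^+ 2 * s); [ring | rewrite H2; ring].
apply/imsetP; exists v; last by rewrite /self_value hv.
rewrite inE; apply: (prim_of_dual rr hs (u := b ord0 + b ord_max)).
rewrite (formDl hs) !(formDr hs) !(formZr hs) h1 h2 h12 h21.
rewrite (_ : _ + _ = H * 2); last by ring.
by rewrite H2 rmorph1 oner_neq0.
Qed.

(** A dual vector u of v can be shifted along v to any fixed length; the result stays primitive
    since its pairing with v remains a unit. *)
Lemma self_values_isotropic v : prim_vec y l v -> res (h v v) = 0 ->
  self_values y l h = level y (fixed_ring conj) l.
Proof.
move=> pv rv; apply/eqP; rewrite eqEsubset self_values_sub /=.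
apply/subsetP => t0 /imsetP[s]; rewrite inE => /eqP cs ->.
have [u uv] := prim_dual rr hs pv.
have [|t ht] := form_scaled_shift rr hs rv (_ : res (h u v) != 0) cs.
  by rewrite uv rmorph1 oner_neq0.
apply/imsetP; exists (u + t *: v); last by rewrite /self_value ht.
rewrite inE; apply: (prim_of_dual rr hs (u := v)).
rewrite (formDr hs) (formZr hs) rmorphD rmorphM rv mulr0 addr0.
by rewrite (formC hs) uv (conj1 rr) rmorph1 oner_neq0.
Qed.

(** Orthogonalize three basis vectors, stopping at once if one of the first two has non-unit length.
    Otherwise the binary form on the first two takes the value opposite to the third length over
    F. *)
Lemma exists_isotropic n (b : 'I_n -> V) : lm_basis b -> (2 < n)%N ->
  exists v, prim_vec y l v /\ res (h v v) = 0.
Proof.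
case: n b => [|[|[|n]]] // b bb _.
pose b0 := b ord0; pose b1 := b (lift ord0 ord0); pose b2 := b ord_max.
have p3 a1 a2 : prim_vec y l (a1 *: b0 + a2 *: b1 + b2) by apply: (basis_prim3 rr bb).
have p2 a : prim_vec y l (a *: b0 + b1).
  have := basis_prim3 rr bb (j := ord0) (i := ord0) a 0 (isT : ord0 != lift ord0 ord0 :>
    'I_n.+3) isT.
  by rewrite scale0r addr0.
have p1 : prim_vec y l b0.
  have := basis_prim3 rr bb (j := ord_max) (i := ord_max) 0 0 (isT : ord_max != ord0 :>
    'I_n.+3) isT.
  by rewrite !scale0r !add0r.
have [r0|r0] := eqVneq (res (h b0 b0)) 0; first by exists b0.
have [d0 hd0] := res_inv rr r0.
pose v1 := (- (d0 * h b0 b1)) *: b0 + b1.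
have [r1|r1] := eqVneq (res (h v1 v1)) 0; first by exists v1; split=> //; apply: p2.
have [d1 hd1] := res_inv rr r1.
have h01 : h b0 v1 = 0.
  by rewrite (formDr hs) (formZr hs); transitivity (h b0 b1 * (1 - h b0 b0 * d0));
    [ring | rewrite hd0 subrr mulr0].
pose v2 := (- (d0 * h b0 b2)) *: b0 + (- (d1 * h v1 b2)) *: v1 + b2.
have h10 : h v1 b0 = 0 by rewrite (formC hs) h01 (conj0 rr).
have h02 : h b0 v2 = 0.
  rewrite !(formDr hs) !(formZr hs) h01.
  by transitivity (h b0 b2 * (1 - h b0 b0 * d0)); [ring | rewrite hd0 subrr mulr0].
have h12 : h v1 v2 = 0.
  rewrite !(formDr hs) !(formZr hs) h10.
  by transitivity (h v1 b2 * (1 - h v1 v1 * d1)); [ring | rewrite hd1 subrr mulr0].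
(* The coefficient of [b2] is still 1 after orthogonalization. *)
have pv a c : prim_vec y l (a *: b0 + c *: v1 + v2).
  rewrite /v2 /v1 !scalerDr !scalerA !addrA.
  rewrite (ACl (1 * 2 * 4 * 5 * 3 * 6 * 7))%AC /= -!scalerDl -(addrA _ (c *: b1))
    -scalerDl.
  exact: p3.
clearbody v1 v2; have [s [t st]] := binary_form_universal (res_two rr) (- res (h v2 v2))
  r0 r1.
have [a ra] := res_surj rr s; have [c rc] := res_surj rr t.
exists (a *: b0 + c *: v1 + v2); split=> //.
have h20 : h v2 b0 = 0 by rewrite (formC hs) h02 (conj0 rr).
have h21 : h v2 v1 = 0 by rewrite (formC hs) h12 (conj0 rr).
have -> : h (a *: b0 + c *: v1 + v2) (a *: b0 + c *: v1 + v2) =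
    a * conj a * h b0 b0 + c * conj c * h v1 v1 + h v2 v2.
  rewrite !(formDr hs) !(formDl hs) !(formZl rr hs) !(formZr hs).
  by rewrite h01 h10 h02 h20 h12 h21; ring.
rewrite !rmorphD !rmorphM !(res_conj rr) ra rc.
by transitivity (res (h b0 b0) * s ^+ 2 + res (h v1 v1) * t ^+ 2 + res (h v2 v2));
  [ring | rewrite st addNr].
Qed.

End SelfValues.

(** * The quotient R[t]/(t^2 - x) as a ramified ring, and its character mu *)

Section RamifiedExtension.
Variables (R : finComUnitRingType) (x : R).

Definition ram_ring : finComNzRingType :=
  HB.pack (ramext x) (Finite.on (ramext x)) (GRing.ComNzRing.on (ramext x)).

Implicit Types (a b : ramext x) (r s : R).

Local Notation rcoef a := ((a : {poly R})`_0).
Local Notation ycoef a := ((a : {poly R})`_1).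

Lemma ramE a : (a : {poly R}) = (rcoef a)%:P + ycoef a *: 'X.
Proof.
apply/polyP => -[|[|i]]; rewrite coefD coefZ coefX coefC /= ?(mulr0,mulr1,addr0,add0r) //.
by rewrite ram_coef_ge2.
Qed.

Lemma ramM_coef a b :
  rcoef (a * b) = rcoef a * rcoef b + ycoef a * ycoef b * x /\
  ycoef (a * b) = rcoef a * ycoef b + ycoef a * rcoef b.
Proof.
have Eab : (a : {poly R}) * (b : {poly R}) =
    ((rcoef a * rcoef b + ycoef a * ycoef b * x)%:P +
       (rcoef a * ycoef b + ycoef a * rcoef b) *: 'X) +
    (ycoef a * ycoef b)%:P * ram_poly x.
  rewrite {1}(ramE a) {1}(ramE b).
  move: (rcoef a) (ycoef a) (rcoef b) (ycoef b) => a0 a1 b0 b1.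
  by rewrite /ram_poly -!mul_polyC !(polyCD, polyCM); ring.
have modE (t : {poly R}) : Pdiv.CommonRing.rmodp t (mk_monic (ram_poly x)) =
    Pdiv.CommonRing.rmodp t (ram_poly x) by rewrite mk_monic_ram.
rewrite poly_of_qpolyM modE Eab.
rewrite Pdiv.RingMonic.rmodpD ?monic_rampoly // Pdiv.RingMonic.rmodp_mull ?monic_rampoly
  //.
rewrite addr0 Pdiv.Ring.rmodp_small ?size_rampoly ?size_lin //.
by rewrite !coefD !coefZ !coefX !coefC /= mulr0 mulr1 addr0 add0r.
Qed.

Lemma ramD_coef a b :
  rcoef (a + b) = rcoef a + rcoef b /\ ycoef (a + b) = ycoef a + ycoef b.
Proof. by rewrite /= !coefD. Qed.

Lemma ramC_coef r : rcoef (qpolyC (ram_poly x) r) = r /\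
  ycoef (qpolyC (ram_poly x) r) = 0.
Proof. by rewrite /= !coefC. Qed.

Lemma ram_exists r s : exists a, rcoef a = r /\ ycoef a = s.
Proof.
exists (in_qpoly _ (r%:P + s *: 'X)).
rewrite in_qpoly_small ?mk_monic_ram ?size_rampoly ?size_lin //.
by rewrite !coefD !coefZ !coefX !coefC /= mulr0 mulr1 addr0 add0r.
Qed.

Lemma ram_conjD : {morph @ram_conj R x : a b / a + b}.
Proof.
move=> a b; have [c0 c1] := ram_conj_coef (a + b).
have [a0 a1] := ram_conj_coef a; have [b0 b1] := ram_conj_coef b.
have [d0 d1] := ramD_coef a b; have [e0 e1] := ramD_coef (ram_conj a) (ram_conj b).
by apply: ram_ext; rewrite ?c0 ?c1 ?d0 ?d1 ?e0 ?e1 ?a0 ?b0 ?a1 ?b1 ?opprD.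
Qed.

Lemma ram_conjM : {morph @ram_conj R x : a b / a * b}.
Proof.
move=> a b; have [c0 c1] := ram_conj_coef (a * b).
have [a0 a1] := ram_conj_coef a; have [b0 b1] := ram_conj_coef b.
have [m0 m1] := ramM_coef a b.
have [n0 n1] := ramM_coef (ram_conj a) (ram_conj b).
by apply: ram_ext; rewrite ?c0 ?c1 ?m0 ?m1 ?n0 ?n1 a0 a1 b0 b1; ring.
Qed.

Lemma ram_conjK : involutive (@ram_conj R x).
Proof.
move=> a; have [c0 c1] := ram_conj_coef (ram_conj a).
by have [a0 a1] := ram_conj_coef a; apply: ram_ext; rewrite ?c0 ?c1 ?a0 ?a1 ?opprK.
Qed.

Lemma ram_conj_real r : ram_conj (qpolyC (ram_poly x) r) = qpolyC _ r.
Proof.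
have [c0 c1] := ram_conj_coef (qpolyC (ram_poly x) r).
by apply: ram_ext; rewrite ?c0 ?c1 // (ramC_coef r).2 oppr0.
Qed.

Lemma ram_conj_y : ram_conj (ram_y x) = - ram_y x.
Proof. by have := ram_conj_yM (1 : ramext x); rewrite ram_conj_real !mulr1. Qed.

Section Residue.
Variables (F : finFieldType) (pi : {rmorphism R -> F}).
Hypothesis pi_x : pi x = 0.

Definition ram_res (a : ram_ring) : F := pi (rcoef (a : ramext x)).

Fact ram_res_zmod : zmod_morphism ram_res.
Proof. by move=> a b; rewrite /ram_res coefB rmorphB. Qed.

Fact ram_res_monoid : monoid_morphism ram_res.
Proof.
split=> [|a b]; rewrite /ram_res; first by rewrite coefC rmorph1.
by rewrite (ramM_coef a b).1 rmorphD !rmorphM pi_x mulr0 addr0.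
Qed.

Definition ram_res_rmorphism : {rmorphism ram_ring -> F} :=
  HB.pack ram_res (GRing.isZmodMorphism.Build _ _ ram_res ram_res_zmod)
    (GRing.isMonoidMorphism.Build _ _ ram_res ram_res_monoid).

End Residue.

Section Ideals.
Variable M : {set R}.
Hypothesis Mx : M = principal_ideal x.

Lemma principal_is_ideal r : is_ideal (principal_ideal r).
Proof.
apply/and3P; split; first by apply/imsetP; exists 0 => //; rewrite mulr0.
apply/forall_inP => a /imsetP[a' _ ->].
apply/forall_inP => b /imsetP[b' _ ->].
by apply/imsetP; exists (a' + b') => //; rewrite mulrDr.
apply/forallP => a; apply/forall_inP => b /imsetP[b' _ ->].
by apply/imsetP; exists (a * b') => //; rewrite mulrCA.
Qed.

Lemma ideal_exp_sub k : ideal_exp M k \subset principal_ideal (x ^+ k).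
Proof.
rewrite /ideal_exp; elim: k => [|k IHk].
  by apply/subsetP => r _; apply/imsetP; exists r; rewrite ?mul1r.
rewrite iterS; apply: bigcap_inf; rewrite principal_is_ideal /=.
apply/subsetP => _ /imset2P[a b aM bI ->]; move: aM; rewrite Mx => /imsetP[a' _ ->].
have /imsetP[b' _ ->] := subsetP IHk b bI.
by apply/imsetP; exists (a' * b'); rewrite // exprS mulrACA.
Qed.

Lemma ideal_exp0 k : 0 \in ideal_exp M k.
Proof.
case: k => [|k]; first by rewrite inE.
by apply/bigcapP => I /andP[/and3P[]].
Qed.

Lemma gen_pred_neq0 l : (0 < l)%N -> nilpotency_degree M l -> x ^+ l.-1 != 0.
Proof.
move=> l0 [_ lmin]; apply/eqP => x0; have := lmin l.-1.
rewrite leqNgt prednK // leqnn => /(_ _)/negP; apply => //.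
apply/eqP; rewrite eqEsubset sub1set ideal_exp0 andbT.
apply: subset_trans (ideal_exp_sub _) _; rewrite x0.
by apply/subsetP => _ /imsetP[r _ ->]; rewrite mul0r inE.
Qed.

End Ideals.

Lemma ramified_ramext (p : nat) (M : {set R}) (l : nat) (F : finFieldType)
    (pi : {rmorphism R -> F}) (pi_x : pi x = 0) :
    p \in [pchar R] -> odd p -> M = principal_ideal x -> (0 < l)%N ->
    nilpotency_degree M l -> (forall c : F, exists a : R, pi a = c) ->
    (forall a : R, (pi a == 0) = (a \in M)) ->
  @ramified_ring ram_ring F (@ram_conj R x) (ram_y x) (ram_res_rmorphism pi_x) l p.
Proof.
move=> chp op Mx l0 nilM pi_surj pi0; split=> //.
- exact: ram_conjD.
- exact: ram_conjM.
- exact: ram_conjK.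
- exact: ram_conj_y.
- move=> c; have [r rc] := pi_surj c; have [a [a0 _]] := ram_exists r 0.
  by exists a; rewrite /= /ram_res a0.
- move=> a; split=> [/eqP|[b ->]].
    rewrite /= /ram_res pi0 Mx => /imsetP[r _ a0].
    have [b [b0 b1]] := ram_exists (ycoef (a : ramext x)) r; exists b.
    have [y0 y1] := ram_yM_coef b.
    by apply: ram_ext; rewrite ?y0 ?y1 ?b0 ?b1 // a0 mulrC.
  by rewrite /= /ram_res (ram_yM_coef b).1 rmorphM pi_x mulr0.
- by move=> a; rewrite /= /ram_res (ram_conj_coef a).1.
- by rewrite exprD; apply: (ram_y_nil Mx nilM).
(* y^(2l-1) = x^(l-1) y, whose y-coefficient is nonzero by minimality of l. *)
- have -> : (l + l).-1 = (l.-1 * 2).+1 by rewrite -{1 2}(prednK l0) addSn addnS muln2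
  addnn.
  rewrite exprS mulnC exprM ram_y2 -rmorphXn; apply/eqP => /(congr1 (fun a : ramext x =>
    ycoef a)).
  rewrite (ram_yM_coef _).2 coefC coef0 /=; apply/eqP.
  exact: (gen_pred_neq0 Mx).
- by rewrite pchar_qpoly.
Qed.

Lemma mulr2_eq0 (p : nat) r : p \in [pchar R] -> odd p -> r *+ 2 = 0 -> r = 0.
Proof.
move=> chp op r2; have : r *+ p.+1 = 0.
  by rewrite -[p.+1]odd_double_half /= op add0n -muln2 mulnC mulrnA r2 mul0rn.
by rewrite mulrS -mulr_natr (pcharf0 chp) mulr0 addr0.
Qed.

Lemma weil_character_mu (lam : R -> algC) (p : nat) :
    p \in [pchar R] -> odd p -> additive_character lam -> primitive_character lam ->
  @weil_character ram_ring (@ram_conj R x) (weil_mu lam).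
Proof.
move=> chp op lamP lamprim; split.
- exact: (weil_muD lamP).
- exact: (weil_mu0 x lamP).
- move=> a ca; rewrite /weil_mu ram_d_selfadj //.
  by case: lamP.
(* [I] is an ideal of R on which lambda is trivial, hence zero; then b = y and b = 1 give the two
   coefficients of a. *)
move=> a mu1; pose I := [set ram_d (b * a : ramext x) | b : ramext x].
have I0 : I = [set 0].
  apply: lamprim; last by move=> r /imsetP[b _ ->]; apply: mu1.
  apply/and3P; split.
  - by apply/imsetP; exists 0 => //; rewrite mul0r ram_d0.
  - apply/forall_inP => r /imsetP[b _ ->]; apply/forall_inP => s /imsetP[c _ ->].
    by apply/imsetP; exists (b + c) => //; rewrite mulrDl ram_dD.
  apply/forallP => r; apply/forall_inP => s /imsetP[b _ ->].
  apply/imsetP; exists (qpolyC _ r * b) => //; rewrite -mulrA /ram_d.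
  by rewrite (ramM_coef (qpolyC _ r) (b * a)).2 (ramC_coef r).1 (ramC_coef r).2 mul0r
    addr0 mulrnAr.
have d0 b : ram_d (b * a : ramext x) = 0.
  by apply/set1P; rewrite -I0; apply: imset_f.
apply: ram_ext; rewrite coef0; apply: (mulr2_eq0 chp op).
  by have := d0 (ram_y x); rewrite /ram_d (ram_yM_coef a).2.
by have := d0 1; rewrite mul1r.
Qed.

End RamifiedExtension.

(** A square root of the residue would lift through [exists_sqrt] to a square root of eps in A fixed
    by conjugation; since 2 is invertible, fixed elements lie in R. *)
Lemma nonsquare_residue (R : finComUnitRingType) (p : nat) (x : R) (l : nat)
    (F : finFieldType) (pi : {rmorphism R -> F}) (pi_x : pi x = 0) (eps : R) :
    p \in [pchar R] -> odd p ->
    @ramified_ring (ram_ring x) F (@ram_conj R x) (ram_y x) (ram_res_rmorphism pi_x) l p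
      ->
    nonsquare_unit eps ->
  forall s : F, s ^+ 2 != pi eps.
Proof.
move=> chp op rr [eps_unit nsq] s; apply/eqP => s2.
have pi_eps : pi eps != 0 by rewrite -unitfE rmorph_unit.
have [a] := fixed_lift rr s; rewrite inE => /eqP ca ra.
have [i ai] : exists i, a * i = 1.
  by apply: (res_inv rr); rewrite ra; apply: contraNneq pi_eps => s0;
    rewrite -s2 s0 expr0n.
have ci := conj_inv rr ca ai; pose e : ram_ring x := qpolyC _ eps.
have re : ram_res_rmorphism pi_x e = pi eps by rewrite /= /ram_res (ramC_coef x eps).1.
have [||rho [crho _ rho2]] := exists_sqrt rr (r := e * i ^+ 2).
- by rewrite (conjM rr) (conjX rr) ci [ram_conj e]ram_conj_real.
- by rewrite rmorphM re -s2 -ra -rmorphXn -rmorphM -exprMn ai expr1n rmorph1.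
have [t [ct Dt]] : exists t : ram_ring x, ram_conj t = t /\ t * t = e.
  exists (rho * a); rewrite (conjM rr) crho ca; split=> //.
  by rewrite mulrACA -!expr2 rho2 -mulrA -exprMn [i * a]mulrC ai expr1n mulr1.
have t1 : ((t : ramext x) : {poly R})`_1 = 0.
  apply: (mulr2_eq0 chp op); have := (ram_conj_coef t).2.
  by rewrite ct mulr2n => {1}->; rewrite addNr.
have Deps : ((t : ramext x) : {poly R})`_0 ^+ 2 = eps.
  rewrite -[RHS](ramC_coef x eps).1 -[qpolyC _ eps]/(e : ramext x) -Dt.
  by rewrite (ramM_coef t t).1 t1 mul0r mul0r addr0.
by apply: (nsq _ _ Deps); rewrite -(unitrX_pos _ (isT : 0 < 2)%N) Deps.
Qed.

Theorem corollary7p9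
  (R : finComUnitRingType) (p : nat)
  (charR : p \in [pchar R]) (odd_p : odd p)
  (M : {set R}) (localR : local_ring M) (principalR : principal_ring R)
  (l : nat) (l_gt0 : (0 < l)%N) (nilM : nilpotency_degree M l)
  (F : finFieldType) (resF : residue_field M F) (q : nat) (cardF : #|F| = q)
  (x : R) (Mx : M = principal_ideal x)
  (V : finLmodType (ramext x)) (m : nat) (m_gt0 : (0 < m)%N)
  (freeV : free_of_rank V m)
  (h : V -> V -> ramext x) (herm_h : hermitian_form h) (nondeg_h : nondegenerate_form h)
  (lam : R -> algC) (charlam : additive_character lam)
  (primlam : primitive_character lam)
  (T : {set V}) (trT : transversal_mod (yV V l) T)
  (eps : R) (nonsq_eps : nonsquare_unit eps) :
  let N := num_irr_constituents (top_repr Mx nilM herm_h charlam trT l_gt0) in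
  [/\ m = 1%N -> N = (q ^ l - q ^ l.-1)%N,
      m = 2%N -> of_type h [:: 1; - eps] -> N = (2 * (q ^ l - q ^ l.-1))%N &
      (2 < m)%N \/ (m = 2%N /\ of_type h [:: 1; -1]) -> N = (2 * q ^ l)%N].
Proof.
move=> N; have [pi [pi_surj pi0]] := resF.
have pi_x : pi x = 0.
  by apply/eqP; rewrite pi0 Mx; apply/imsetP; exists 1 => //; rewrite mulr1.
have rr := ramified_ramext pi_x charR odd_p Mx l_gt0 nilM pi_surj pi0.
have [b bb] := freeV.
have hs : @hermitian_space (ram_ring x) (@ram_conj R x) (ram_y x) l V h.
  case: (herm_h) => hl hr hz hc; split=> //.
    (* A vector orthogonal to V and the vector 0 represent the same functional, so they coincide. *)
    move=> v v0; have [w [_ wu]] := nondeg_h (\0 : {linear V -> (ramext x)^o}).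
    have wE u : h u v = 0 -> h v u = 0.
      by move=> uv; rewrite hc uv; apply: (conj0 rr).
    rewrite -(wu v) ?(wu 0) // => u; last exact: wE.
    by have := hz 0 u 0; rewrite scale0r mul0r => e; rewrite hc e; apply: (conj0 rr).
  exact: (basis_torsion rr bb).
have mc : @weil_character (ram_ring x) (@ram_conj R x) (weil_mu lam).
  exact: (weil_character_mu x charR odd_p charlam primlam).
have memU (g : {perm V}) : g \in unitary_group h <-> @isometry_of (ram_ring x) V h g.
  by split=> [/unitaryP|/unitaryP].
(* y^k V is the annihilator of y^(2l-k); k = l and k = 1 translate congruence modulo iV and
   primitivity into the abstract setting. *)
have yVE k v : (k <= l + l)%N -> (v \in yV V k) = (ram_y x ^+ (l + l - k) *: v == 0).
  move=> kl; apply/imsetP/eqP => [[w _ ->]|yv].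
    by rewrite scalerA -exprD subnK // (y_nilp rr) scale0r.
  have [w ->] := y_torsion hs (leq_subr k (l + l)) yv.
  by exists w => //; rewrite subKn.
have yVl v : (v \in yV V l) = (ram_y x ^+ l *: v == 0) by rewrite yVE ?leq_addr // addnK.
have primE v : primitive_vector v = @prim_vec (ram_ring x) (ram_y x) l V v.
  by rewrite /primitive_vector yVE ?subn1 // (leq_trans l_gt0) ?leq_addr.
have transT v : exists! t, t \in T /\ ram_y x ^+ l *: (v - t) = 0.
  have [t [[tT vt] tu]] := trT v; exists t; split; first by split=> //; apply/eqP;
    rewrite -yVl.
  by move=> t' [t'T /eqP]; rewrite -yVl => vt'; apply: tu.
have NE : N = (#|@norm_one_values (ram_ring x) (@ram_conj R x) (ram_y x) l| *
    #|@self_values (ram_ring x) (ram_y x) l V h|)%N.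
  apply: (card_irr_constt_top rr hs mc memU transT).
    by move=> g i j; rewrite /= mxE /= yVl.
  by apply: eq_bigl => i; apply: primE.
have eps_unit : pi eps != 0 by rewrite -unitfE rmorph_unit // nonsq_eps.1.
split=> [m1|m2 [_ [b' [bb' gram]]]|].
- subst m; rewrite NE (self_values_rank1 rr hs bb) (card_norm_values rr).
  by rewrite cardF.
- rewrite NE (@self_values_anisotropic _ _ _ _ _ _ _ rr _ _ hs b' (qpolyC _ eps) bb').
  + by rewrite (count_fixed_units rr) cardF.
  + by rewrite gram.
  + by rewrite gram /= qpolyCN.
  + by rewrite gram.
  + by rewrite /= /ram_res (ramC_coef x eps).1.
  + move=> s; rewrite /= /ram_res (ramC_coef x eps).1.
    exact: (nonsquare_residue charR odd_p rr nonsq_eps).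
case=> [m3|[m2 [_ [b' [bb' gram]]]]].
  have [v [pv rv]] := exists_isotropic rr hs bb m3.
  by rewrite NE (self_values_isotropic rr hs pv rv) (count_fixed rr) cardF.
rewrite NE (@self_values_hyperbolic _ _ _ _ _ _ _ rr _ _ hs b').
+ by rewrite (count_fixed rr) cardF.
+ by rewrite gram.
+ by rewrite gram /= qpolyCN.
+ by rewrite gram.
Qed.
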